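(* Let $\delta>0$. The semigroup $\mathfrak{S}$ on $\mathcal{P}^\delta_{2,c}$ generated by the discrete quadratic porous medium equation $\dot\rho_\kappa=\big(\Delta^{\!\delta}(\rho^2)\big)_\kappa$, $\kappa\in\mathbb{Z}$, is $0$-contractive (i.e. contractive) with respect to the energy $\mathcal{E}(\rho)=-\frac{\delta^3}{4}\sum_{\kappa,\lambda\in\mathbb{Z}}|\kappa-\lambda|\rho_\kappa\rho_\lambda$.
   Context: Fix $\delta>0$. For $f:\mathbb{Z}\to\mathbb{R}$, $(\Delta^{\!\delta} f)_\kappa=(f_{\kappa+1}+f_{\kappa-1}-2f_\kappa)/\delta^2$, and $(\rho^2)_\kappa=\rho_\kappa^2$. $\mathcal{P}^\delta_{2,c}$ is the set of $\rho:\mathbb{Z}\to[0,\infty)$ with $\delta\sum_\kappa\rho_\kappa=1$, $\delta\sum_\kappa(\delta\kappa)^2\rho_\kappa<\infty$, $\delta\sum_\kappa(\delta\kappa)\rho_\kappa=0$. Define $Q(p,r)=p^2/r$ if $r>0$, $Q(0,0)=0$, $Q(p,0)=+\infty$ if $p\ne0$. $\mathcal{C}(\rho^0,\rho^1)$ is the set of pairs $(\rho,\mathfrak{w})$, $\rho:[0,1]\to\mathcal{P}^\delta_{2,c}$, $\mathfrak{w}:[0,1]\to\ell^2$, with $\rho(0)=\rho^0$, $\rho(1)=\rho^1$, $\rho_\kappa\in H^1(0,1)$, $\mathfrak{w}_\kappa\in L^2(0,1)$ and $\dot\rho_\kappa=(\Delta^{\!\delta}\mathfrak{w})_\kappa$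 a.e., for each $\kappa$. ${\mathbb{D}}^\delta(\rho^0,\rho^1)^2=\inf_{\mathcal{C}(\rho^0,\rho^1)}\delta\sum_\kappa\int_0^1Q(\mathfrak{w}_\kappa(s),\rho_\kappa(s))\,ds$. A semigroup $\mathfrak{S}$ on $\mathcal{P}^\delta_{2,c}$ is $\lambda$-contractive with respect to $\mathcal{E}$ if for all $\bar\rho,\bar\eta\in\mathcal{P}^\delta_{2,c}$ with ${\mathbb{D}}^\delta(\bar\rho,\bar\eta)<\infty$: $$\limsup_{t\downarrow0}\frac{{\mathbb{D}}^\delta(\mathfrak{S}^t\bar\rho,\bar\eta)^2-{\mathbb{D}}^\delta(\bar\rho,\bar\eta)^2}{2t}+\frac\lambda2{\mathbb{D}}^\delta(\bar\rho,\bar\eta)^2\le\mathcal{E}(\bar\eta)-\mathcal{E}(\bar\rho).$$ *)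

(* Defs.v *)
From HB Require Import structures.
From mathcomp Require Import all_boot all_order all_algebra.
From mathcomp Require Import all_classical all_reals all_analysis.
Set Implicit Arguments. Unset Strict Implicit. Unset Printing Implicit Defensive.
Import Order.TTheory GRing.Theory Num.Theory.
Import numFieldNormedType.Exports.
Local Open Scope classical_set_scope.
Local Open Scope ring_scope.

Section Defs.
Variable R : realType.

Definition lapd (delta : R) (f : int -> R) (k : int) : R :=
  (f (k + 1)%R + f (k - 1)%R - 2 * f k) / delta ^+ 2.

Definition sqz (f : int -> R) : int -> R := fun k => f k ^+ 2.

Definition Pd2c (delta : R) (rho : int -> R) : Prop :=
  [/\ (forall k, 0 <= rho k),
      ((delta%:E * \esum_(k in [set: int]) (rho k)%:E) = 1)%E,
      (\esum_(k in [set: int]) (((delta * k%:~R) ^+ 2) * rho k)%:E < +oo)%E &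
      (* delta * sum_k (delta k) rho_k = 0; the series is absolutely
         convergent by the previous condition, so this says the sum over
         positive k equals the sum over negative k of |delta k| rho_k *)
      (\esum_(k in [set k : int | (0 < k)%R]) ((delta * k%:~R) * rho k)%:E
        = \esum_(k in [set k : int | (k < 0)%R]) ((- (delta * k%:~R)) * rho k)%:E)%E].

Definition Qf (p r : R) : \bar R :=
  if 0 < r then (p ^+ 2 / r)%:E else if p == 0 then 0%E else +oo%E.

(* admissible pairs C(rho0, rho1): curves rho, w : R -> (int -> R),
   only their values on [0,1] matter *)
Definition admissible (delta : R) (rho0 rho1 : int -> R)
    (rho w : R -> int -> R) : Prop :=
  [/\ (forall s, 0 <= s <= 1 -> Pd2c delta (rho s)),
      rho 0 = rho0 /\ rho 1 = rho1,
      (forall s, 0 <= s <= 1 ->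
         (\esum_(k in [set: int]) ((w s k) ^+ 2)%:E < +oo)%E),
      (forall k, measurable_fun (`[0%R, 1%R] : set R) (fun s => w s k) /\
         (\int[lebesgue_measure]_(s in `[0%R, 1%R]) ((w s k) ^+ 2)%:E < +oo)%E) &
      (* rho_k in H^1(0,1) with rho_k' = (Lap w)_k a.e.: absolutely
         continuous representative, rho_k(s) = rho_k(0) + int_0^s (Lap w)_k *)
      (forall k s, 0 <= s <= 1 ->
         (\int[lebesgue_measure]_(r in `[0%R, s]) (lapd delta (w r) k)%:E
            = (rho s k - rho 0 k)%:E)%E)].

Definition action (delta : R) (rho w : R -> int -> R) : \bar R :=
  (delta%:E * \esum_(k in [set: int])
     \int[lebesgue_measure]_(s in `[0%R, 1%R]) Qf (w s k) (rho s k))%E.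

Definition Dd2 (delta : R) (rho0 rho1 : int -> R) : \bar R :=
  ereal_inf [set a | exists (rho w : R -> int -> R),
                        admissible delta rho0 rho1 rho w /\ a = action delta rho w].

Definition energy (delta : R) (rho : int -> R) : \bar R :=
  (- ((delta ^+ 3 / 4)%:E *
     \esum_(p in [set: int * int])
        ((`|p.1 - p.2|%:~R : R) * rho p.1 * rho p.2)%:E))%E.

Definition pme_semigroup (delta : R) (S : R -> (int -> R) -> (int -> R)) : Prop :=
  forall rho, Pd2c delta rho ->
  [/\ (forall t, 0 <= t -> Pd2c delta (S t rho)),
      S 0 rho = rho,
      (forall t s, 0 <= t -> 0 <= s -> S (t + s) rho = S t (S s rho)),
      (forall k, {within (`[0%R, +oo[ : set R), continuous (fun t : R => S t rho k)}) &
      (forall (k : int) (t : R), 0 < t ->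
         is_derive t (1 : R) (fun t : R => S t rho k) (lapd delta (sqz (S t rho)) k))].

Definition lambda_contractive (delta lambda : R)
    (S : R -> (int -> R) -> (int -> R)) (E : (int -> R) -> \bar R) : Prop :=
  forall rhob etab, Pd2c delta rhob -> Pd2c delta etab ->
    (Dd2 delta rhob etab < +oo)%E ->
    (limf_esup (fun t : R =>
        ((Dd2 delta (S t rhob) etab - Dd2 delta rhob etab) * ((2 * t)^-1)%:E))
       (0%R)^'+
     + (lambda / 2)%:E * Dd2 delta rhob etab <= E etab - E rhob)%E.

End Defs.

(* Main.v *)
Require Import Defs.
From HB Require Import structures.
From mathcomp Require Import all_boot all_order all_algebra.
From mathcomp Require Import all_classical all_reals all_analysis.
From mathcomp Require Import measurable_realfun.
From mathcomp Require Import zify ring lra.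
Set Implicit Arguments. Unset Strict Implicit. Unset Printing Implicit Defensive.
Import Order.TTheory GRing.Theory Num.Theory.
Import numFieldNormedType.Exports.
Local Open Scope classical_set_scope.
Local Open Scope ring_scope.

(** An Eulerian argument in the style of Daneri and Savare. Let [(rho, w)] be an
    admissible pair from [rhob] to [etab] of almost minimal action. The curve
    [s |-> S^{h (1 - s)} rho^s] joins [S^h rhob] to [etab] and has potential
    [U - h rho^2], where [U] solves the linearised equation [U' = 2 rho lapd U]
    with initial value [w^s]. Along this flow [sum U^2 / rho] decreases: its
    derivative is a sum over edges of [- (3 (U - U')^2 + (v' rho - v rho')^2)]
    with [U = v rho]. Expanding the square in the action leaves the cross term
    [- 2 h delta sum w_h rho_h] up to a nonpositive [- h^2 rho^3], and
    [- delta sum w rho] is the derivative of the energy along any admissible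
    curve. Hence [Dd2 (S^h rhob) etab <= Dd2 rhob etab + 2 h (E etab - E (S^h rhob))],
    and [E (S^h rhob) >= E rhob - O(h)] because the same curve construction
    applies to the constant curve. On a short time interval both flows are given
    by power series in time, which provides existence, uniqueness, joint
    measurability and the chain rule in [s]. *)

(** * Sums over the integers *)

(** Vacuum and infinite sums shape the proof. A density may vanish at some sites, where [U^2 / rho]
    is 0 / 0 at time 0; the flow makes every site positive at once, and the quotient is followed
    from positive times back to 0. Sums over the integers are cut to finite windows, and the
    boundary terms must vanish although [w] is only known to be square summable. The linearised
    equation is written for the potential: if [b' = lapd (2 a b)] and [b = lapd U], then
    [U' = 2 a lapd U] preserves this form, so the evolved curve again solves a continuity equation.
    Analyticity in time is cheap on the lattice, where [lapd] is bounded: unit mass gives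
    [rho <= 1 / delta], so one radius of convergence serves all densities, hence all [s] and all
    curves, and one threshold on [h] is valid before the infimum is taken. In [s] nothing better
    than measurability of [w] is available; infinite sums are therefore differentiated in [s] by
    dominated convergence. *)

Section IntSums.
Variable R : realType.
Local Open Scope ereal_scope.

(* The sum of [f] over [- N <= k < N], since [Negz n = - (n + 1)]. *)
Definition window (f : int -> R) (N : nat) : R :=
  (\sum_(n < N) (f (Posz n) + f (Negz n)))%R.

Lemma esum_int (f : int -> \bar R) : (forall k, 0 <= f k) ->
  \esum_(k in [set: int]) f k = \sum_(0 <= n <oo) (f (Posz n) + f (Negz n)).
Proof.
move=> f0.
rewrite (esumID (range Posz))//.
rewrite !setTI nneseriesD//.
have inj1 : {in [set: nat] &, injective Posz} by move=> x y _ _ [].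
have inj2 : {in [set: nat] &, injective Negz} by move=> x y _ _ [].
congr (_ + _).
  rewrite (reindex_esum [set: nat] _ Posz)//.
  - by rewrite nneseries_esumT.
  - by split.
rewrite (reindex_esum [set: nat] _ Negz)//.
- by rewrite nneseries_esumT.
- split=> //.
  + by move=> n _ [].
  + move=> [n|n] /= h; last by exists n.
    by exfalso; apply: h; exists n.
Qed.

Lemma esum_intZl (c : R) (f : int -> \bar R) : (0 <= c)%R -> (forall k, 0 <= f k) ->
  \esum_(k in [set: int]) (c%:E * f k) =
  c%:E * \esum_(k in [set: int]) f k.
Proof.
move=> c0 f0.
rewrite !esum_int//; last by move=> k; rewrite mule_ge0.
rewrite -nneseriesZl; last by move=> n _; rewrite adde_ge0.
by apply: eq_eseriesr => n _; rewrite muleDr// ge0_adde_def// inE.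
Qed.

Lemma window_EFin (f : int -> R) N :
  (window f N)%:E = \sum_(0 <= n < N) ((f (Posz n))%:E + (f (Negz n))%:E).
Proof. by rewrite /window big_mkord -sumEFin. Qed.

Lemma cvg_window (f : int -> R) : (forall k, 0 <= f k)%R ->
  (window f N)%:E @[N --> \oo] --> \esum_(k in [set: int]) (f k)%:E.
Proof.
move=> f0; rewrite esum_int//.
under eq_fun do rewrite window_EFin.
by apply: is_cvg_ereal_nneg_natsum => n _; rewrite -EFinD lee_fin addr_ge0.
Qed.

Lemma window_le_esum (f : int -> R) N : (forall k, 0 <= f k)%R ->
  (window f N)%:E <= \esum_(k in [set: int]) (f k)%:E.
Proof.
move=> f0; rewrite esum_int// window_EFin.
by apply: nneseries_lim_ge => n _ _; rewrite -EFinD lee_fin addr_ge0.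
Qed.

Lemma term_le_esum (f : int -> R) k : (forall k, 0 <= f k)%R ->
  (f k)%:E <= \esum_(k in [set: int]) (f k)%:E.
Proof.
move=> f0; rewrite -(@esum_set1 R int k (fun k => (f k)%:E))//.
apply: esum_ge; exists [set k] => //.
  by rewrite esum_fset// => i _; rewrite lee_fin.
by rewrite lee_fin.
Qed.

Lemma summable_terms_cvg0 (f : int -> R) : (forall k, 0 <= f k)%R ->
  \esum_(k in [set: int]) (f k)%:E < +oo ->
  (f (Posz N) @[N --> \oo] --> 0)%R /\ (f (Negz N) @[N --> \oo] --> 0)%R.
Proof.
move=> f0 foo.
have E : \esum_(k in [set: int]) (f k)%:E \is a fin_num.
  by rewrite ge0_fin_numE//; apply: esum_ge0 => k _; rewrite lee_fin.
have c : (window f N @[N --> \oo] --> fine (\esum_(k in [set: int]) (f k)%:E))%R.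
  by move: (cvg_window f0); rewrite -{1}(fineK E) => /fine_cvg.
have t : (f (Posz N) + f (Negz N) @[N --> \oo] --> 0)%R.
  apply: (@cvg_series_cvg_0 _ (R : normedModType R) (fun n => f (Posz n) + f (Negz n))%R).
  apply/cvg_ex; exists (fine (\esum_(k in [set: int]) (f k)%:E)).
  move: c; apply: cvg_trans; apply: near_eq_cvg.
  by near=> N; rewrite /window /series/= big_mkord.
have sq g : (forall N, 0 <= g N <= f (Posz N) + f (Negz N))%R -> (g N @[N --> \oo] --> 0)%R.
  move=> gf; apply: (squeeze_cvgr _ (cvg_cst (0%R : R)) t).
  by near=> N; exact: gf.
by split; apply: sq => N; rewrite f0/= ?lerDl ?lerDr.
Unshelve. all: by end_near. Qed.

Lemma integral_esum (d : measure_display) (T : measurableType d)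
    (mu : {measure set T -> \bar R}) (D : set T) (f : int -> T -> \bar R) :
  measurable D -> (forall k, measurable_fun D (f k)) ->
  (forall k x, D x -> 0 <= f k x) ->
  \int[mu]_(x in D) (\esum_(k in [set: int]) f k x) =
  \esum_(k in [set: int]) \int[mu]_(x in D) f k x.
Proof.
move=> mD mf f0.
rewrite esum_int; last by move=> k; apply: integral_ge0 => x Dx; exact: f0.
under eq_integral => x xD.
  rewrite esum_int; last by move=> k; apply: f0; exact: set_mem.
  over.
rewrite integral_nneseries//.
- apply: eq_eseriesr => n _; rewrite ge0_integralD//; [exact: f0|exact: f0].
- by move=> n; apply: emeasurable_funD.
- by move=> n x Dx; rewrite adde_ge0 ?f0.
Qed.

Lemma measurable_esum (d : measure_display) (T : measurableType d)
    (D : set T) (f : int -> T -> \bar R) :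
  measurable D -> (forall k, measurable_fun D (f k)) ->
  (forall k x, D x -> 0 <= f k x) ->
  measurable_fun D (fun x => \esum_(k in [set: int]) f k x).
Proof.
move=> mD mf f0.
apply: (eq_measurable_fun (fun x => \sum_(0 <= n <oo) (f (Posz n) x + f (Negz n) x))).
  by move=> x xD; rewrite esum_int// => k; apply: f0; exact: set_mem.
apply: ge0_emeasurable_sum => //.
- by move=> n x Dx _; rewrite adde_ge0 ?f0.
- by move=> n _; apply: emeasurable_funD.
Qed.

End IntSums.

(** * Absolutely continuous functions on [0, 1] *)

Section Primitives.
Variable R : realType.
Implicit Types (f g : R -> R) (s t : R).
Local Notation mu := (@lebesgue_measure R).
Local Notation I01 := (`[0%R, 1%R]%classic : set R).

Let mI s : measurable (`[0%R, s]%classic : set R). Proof. exact: measurable_itv. Qed.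

(* On [0, 1], [f] is absolutely continuous with derivative [f']. *)
Definition prim f f' : Prop :=
  mu.-integrable I01 (EFin \o f') /\
  forall s, 0 <= s <= 1 -> f s = f 0 + \int[mu]_(r in `[0%R, s]) f' r.

Lemma sub01 s : 0 <= s <= 1 -> (`[0%R, s]%classic : set R) `<=` `[0%R, 1%R].
Proof.
move=> /andP[_ s1] x /=; rewrite !in_itv/= => /andP[-> xs].
exact: le_trans s1.
Qed.

Lemma integrable_sub01 f s : 0 <= s <= 1 ->
  mu.-integrable I01 (EFin \o f) ->
  mu.-integrable `[0%R, s] (EFin \o f).
Proof. by move=> s01; apply: integrableS => //; exact: sub01. Qed.

Lemma prim_integral f f' s : prim f f' -> 0 <= s <= 1 ->
  (\int[mu]_(r in `[0%R, s]) (f' r)%:E = (f s - f 0)%:E)%E.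
Proof.
move=> [fi fE] s01; rewrite (fE s s01) (addrC (f 0)) addrK /Rintegral fineK//.
by apply: integrable_fin_num => //; exact: integrable_sub01.
Qed.

Lemma primP f f' : mu.-integrable I01 (EFin \o f') ->
  (forall s, 0 <= s <= 1 ->
    (\int[mu]_(r in `[0%R, s]) (f' r)%:E = (f s - f 0)%:E)%E) -> prim f f'.
Proof.
move=> fi fE; split=> // s s01.
by rewrite /Rintegral fE//= addrC subrK.
Qed.

Lemma prim_cst c : prim (fun=> c) (fun=> 0).
Proof.
split; first exact: integrable0.
by move=> s _; rewrite Rintegral_cst// mul0r addr0.
Qed.

Lemma prim_id : prim id (fun=> 1).
Proof.
split.
  apply: (@measurable_bounded_integrable _ _ _ mu (fun=> 1)) => //.
    have := @lebesgue_measure_itv R `[0%R, 1%R]; rewrite /= lte_fin ltr01 => ->.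
    by rewrite -EFinD ltry.
  by exists 1; split=> // x x1 y _; rewrite normr1 ltW.
move=> s /andP[s0 s1]; rewrite Rintegral_cst// mul1r add0r.
have := @lebesgue_measure_itv R `[0%R, s]; rewrite /= lte_fin => ->.
case: ltP => s0'/=; first by rewrite subr0.
by apply/eqP; rewrite eq_le s0 s0'.
Qed.

Lemma primD f f' g g' : prim f f' -> prim g g' ->
  prim (fun s => f s + g s) (fun s => f' s + g' s).
Proof.
move=> [fi fE] [gi gE]; split.
  by have := @integrableD _ _ _ mu _ (mI 1) _ _ fi gi.
move=> s s01; rewrite RintegralD//; [|exact: integrable_sub01..].
by rewrite (fE s s01) (gE s s01) addrACA.
Qed.

Lemma primZ c f f' : prim f f' -> prim (fun s => c * f s) (fun s => c * f' s).
Proof.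
move=> [fi fE]; split.
  by have := @integrableZl _ _ _ mu _ (mI 1) c _ fi.
move=> s s01; rewrite RintegralZl//; last exact: integrable_sub01.
by rewrite (fE s s01) mulrDr.
Qed.

Lemma prim_sum n (f f' : nat -> R -> R) : (forall i, (i < n)%N -> prim (f i) (f' i)) ->
  prim (fun s => \sum_(i < n) f i s) (fun s => \sum_(i < n) f' i s).
Proof.
elim: n => [|n IH] h.
  have := prim_cst 0; congr prim; apply/funext => s; by rewrite big_ord0.
have /primD/(_ (h n (ltnSn n))) : prim (fun s => \sum_(i < n) f i s) (fun s => \sum_(i < n) f' i s).
  by apply: IH => i ni; apply: h; exact: ltnW.
by congr prim; apply/funext => s; rewrite big_ord_recr.
Qed.

Lemma eq_prim f f' g g' :
  (forall s, 0 <= s <= 1 -> f s = g s) -> (forall s, 0 <= s <= 1 -> f' s = g' s) ->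
  prim f f' -> prim g g'.
Proof.
move=> fg fg' [fi fE]; split.
  apply: eq_integrable fi => // x; rewrite inE/= in_itv/= => x01.
  by rewrite fg'.
move=> s s01; rewrite -fg// -fg ?lexx ?ler01// fE//; congr (_ + _).
apply: eq_Rintegral => x /set_mem/(sub01 s01)/=; rewrite in_itv/= => x01.
by rewrite fg'.
Qed.

Lemma prim_continuous f f' : prim f f' -> {within `[0%R, 1%R], continuous f}.
Proof.
move=> [fi fE].
pose g (x : R) : R := f 0 + parameterized_integral mu 0 x f'.
apply: (@subspace_eq_continuous _ _ _ (g : subspace `[0%R, 1%R] -> R)).
  by move=> x; rewrite inE/= in_itv/= => x01; rewrite [RHS]fE.
have := parameterized_integral_continuous ler01 fi.
by move=> h x; apply: (@cvgD _ (R : normedModType R)); [exact: cvg_cst|exact: h].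
Qed.

Lemma prim_measurable f f' : prim f f' -> measurable_fun I01 f.
Proof.
by move=> h; apply: subspace_continuous_measurable_fun => //; exact: prim_continuous h.
Qed.

Lemma prim_bounded f f' : prim f f' -> exists B : R, forall s, 0 <= s <= 1 -> `|f s| <= B.
Proof.
move=> /prim_continuous fc.
have [a _ fa] := EVT_max ler01 fc; have [b _ fb] := EVT_min ler01 fc.
exists (`|f a| + `|f b|) => s s01; have s01' : s \in `[0%R, 1%R] by rewrite in_itv.
have := fa _ s01'; have := fb _ s01'.
have := ler_norm (f a); have := ler_norm (- f b); rewrite normrN => *.
rewrite ler_norml; apply/andP; split; have := normr_ge0 (f a); have := normr_ge0 (f b); lra.
Qed.

Lemma integrableM_bounded f g (B : R) :
  measurable_fun I01 g -> (forall s, 0 <= s <= 1 -> `|g s| <= B) ->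
  mu.-integrable I01 (EFin \o f) ->
  mu.-integrable I01 (EFin \o (fun s => f s * g s)).
Proof.
move=> mg gB fi.
have := @integrableMl _ _ _ mu _ (mI 1) _ _ fi mg; apply.
exists B; split; first exact: num_real.
move=> x Bx y /=; rewrite in_itv/= => /gB /le_trans; apply; exact: ltW.
Qed.

(** Fubini for [f x * g y] on the triangle [y < x] of the square over [[0, s]]; it is integration by
    parts before any primitive is named. *)
Lemma integral_triangle (f g : R -> R) s : 0 <= s <= 1 ->
  mu.-integrable I01 (EFin \o f) ->
  mu.-integrable I01 (EFin \o g) ->
  (\int[mu]_(x in `[0%R, s]) (f x * \int[mu]_(y in `[0%R, x]) g y)%:E =
   \int[mu]_(y in `[0%R, s]) (g y * (\int[mu]_(x in `[0%R, s]) f x - \int[mu]_(x in `[0%R, y]) f x))%:E)%E.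
Proof.
move=> s01 fi gi.
pose D : set R := `[0%R, s]%classic; have mD : measurable D by exact: mI.
have fiD := integrable_sub01 s01 fi; have giD := integrable_sub01 s01 gi.
pose p := f \_ D; pose q := g \_ D.
have pi : mu.-integrable setT (EFin \o p).
  by have /(@integrable_mkcond _ _ _ mu _ (EFin \o f) mD) := fiD; rewrite restrict_EFin.
have qi : mu.-integrable setT (EFin \o q).
  by have /(@integrable_mkcond _ _ _ mu _ (EFin \o g) mD) := giD; rewrite restrict_EFin.
have mp : measurable_fun setT p by apply/measurable_EFinP; exact: measurable_int pi.
have mq : measurable_fun setT q by apply/measurable_EFinP; exact: measurable_int qi.
(* The strict inequality has sections [[0, x[] and []y, s]]: the first differs from [[0, x]] by a
   null point, and the second is the range left when the two integrals of [f] are subtracted. *)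
pose k (z : R * R) : \bar R := (if z.2 < z.1 then p z.1 * q z.2 else 0)%:E.
have mk : measurable_fun setT k.
  apply/measurable_EFinP; apply: measurable_fun_ifT => //.
  - by apply: measurable_fun_ltr; [exact: measurable_snd|exact: measurable_fst].
  - by apply: measurable_funM; apply: measurableT_comp.
have ki : (mu \x mu)%E.-integrable setT k.
  (* [k] is dominated by [|p x| * |q y|], whose double integral is a product of two finite norms. *)
  apply/(integrable12ltyP mu mu mk).
  apply: (@le_lt_trans _ _ (\int[mu]_x (`|p x|%:E * \int[mu]_y `|q y|%:E))%E).
    apply: ge0_le_integral => //.
    - by move=> x _; apply: integral_ge0.
    - apply: (@measurable_fun_fubini_tonelli_F _ _ _ _ _ mu (abse \o k)) => //.
        exact: measurableT_comp.
      by move=> x; exact: abse_ge0.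
    - apply: emeasurable_funM => //; apply/measurable_EFinP; exact: measurableT_comp.
    - move=> x _; rewrite -ge0_integralZl//; last first.
        by apply/measurable_EFinP; exact: measurableT_comp.
      apply: ge0_le_integral => //.
      + apply: measurableT_comp => //; apply/measurable_EFinP.
        rewrite /=; apply: measurable_fun_ifT => //; first exact: measurable_fun_ltr.
        exact: measurable_funM.
      + apply: emeasurable_funM => //; apply/measurable_EFinP; exact: measurableT_comp.
      + move=> y _; rewrite /k/= -EFinM lee_fin; case: ifP => _.
          by rewrite normrM.
        by rewrite normr0 mulr_ge0.
  have /integrableP[_ pfin] := pi; have /integrableP[_ qfin] := qi.
  have qfn : (\int[mu]_y `|q y|%:E)%E \is a fin_num.
    by rewrite ge0_fin_numE//; apply: integral_ge0.
  have pfn : (\int[mu]_y `|p y|%:E)%E \is a fin_num.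
    by rewrite ge0_fin_numE//; apply: integral_ge0.
  rewrite -(fineK qfn) ge0_integralZr//.
  - by move: pfn => /fineK <-; rewrite -EFinM ltry.
  - by apply/measurable_EFinP; exact: measurableT_comp.
  - by rewrite lee_fin fine_ge0// integral_ge0.
have E1 : (\int[mu]_x \int[mu]_y k (x, y) =
    \int[mu]_(x in D) (f x * \int[mu]_(y in `[0%R, x]) g y)%:E)%E.
  rewrite [RHS]integral_mkcond; apply: eq_integral => x _.
  rewrite [RHS]patchE; case: ifPn => xD; last first.
    rewrite (@eq_integral _ _ _ _ _ (cst 0%E)) ?integral0// => y _.
    by rewrite /k/= /p patchE (negbTE xD) mul0r; case: ifP.
  have xs : 0 <= x <= s by move: xD; rewrite inE /D/= in_itv.
  have x01 : 0 <= x <= 1.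
    by move: xs s01 => /andP[-> xs] /andP[_ s1]; exact: le_trans s1.
  have gx := integrable_sub01 x01 gi.
  rewrite EFinM /Rintegral fineK; last exact: integrable_fin_num.
  rewrite -integralZl// -integral_itv_bndo_bndc; last first.
    apply/measurable_EFinP; apply: measurable_funM => //.
    apply: (@measurable_funS _ _ _ _ `[0%R, x]) => //.
      by apply: subset_itvl; rewrite bnd_simp.
    by apply/measurable_EFinP; exact: measurable_int gx.
  rewrite [RHS]integral_mkcond; apply: eq_integral => y _.
  rewrite [RHS]patchE /k/= /p patchE xD /q patchE.
  have -> : (y \in `[0%R, x[%classic) = (0 <= y < x).
    by apply/idP/idP; rewrite inE/= in_itv.
  have -> : (y \in D) = (0 <= y <= s).
    by apply/idP/idP; rewrite inE /D/= in_itv.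
  case: ltP => yx; last by rewrite andbF.
  rewrite andbT; have -> : y <= s by move: xs => /andP[_]; apply: le_trans; exact: ltW.
  by rewrite andbT; case: ifP => // _; rewrite mulr0.
have E2 : (\int[mu]_y \int[mu]_x k (x, y) =
    \int[mu]_(y in D) (g y * (\int[mu]_(x in D) f x - \int[mu]_(x in `[0%R, y]) f x))%:E)%E.
  rewrite [RHS]integral_mkcond; apply: eq_integral => y _.
  rewrite [RHS]patchE; case: ifPn => yD; last first.
    rewrite (@eq_integral _ _ _ _ _ (cst 0%E)) ?integral0// => x _.
    by rewrite /k/= /q patchE (negbTE yD) mulr0; case: ifP.
  have ys : 0 <= y <= s by move: yD; rewrite inE /D/= in_itv.
  move: (ys) => /andP[y0 ys'].
  rewrite Rintegral_itvB//.
  have fy : mu.-integrable `]y, s] (EFin \o f).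
    by apply: integrableS fiD => //; apply: subset_itvr; rewrite bnd_simp.
  rewrite EFinM /Rintegral fineK; last exact: integrable_fin_num.
  rewrite -integralZl//.
  rewrite [RHS]integral_mkcond; apply: eq_integral => x _.
  rewrite [RHS]patchE /k/= /q patchE yD /p patchE.
  have -> : (x \in `]y, s]%classic) = (y < x <= s).
    by apply/idP/idP; rewrite inE/= in_itv.
  have -> : (x \in D) = (0 <= x <= s).
    by apply/idP/idP; rewrite inE /D/= in_itv.
  case: ltP => yx //=.
  have -> : 0 <= x by apply: (le_trans y0); exact: ltW.
  rewrite andTb; case: ifP => _/=; last exact: (congr1 EFin (mul0r _)).
  by rewrite -EFinM; congr EFin; exact: mulrC.
by rewrite -E1 -E2; exact: Fubini ki.
Qed.

(** The factors are only absolutely continuous, so the product rule is obtained in integrated form: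
    [integral_triangle] is rewritten with the increments [F] and [G] of the two factors from 0. *)
Lemma primM f f' g g' : prim f f' -> prim g g' ->
  prim (fun s => f s * g s) (fun s => f' s * g s + g' s * f s).
Proof.
move=> pf pg; have [fi fE] := pf; have [gi gE] := pg.
have mf := prim_measurable pf; have mg := prim_measurable pg.
have [Bf hBf] := prim_bounded pf; have [Bg hBg] := prim_bounded pg.
have i1 := integrableM_bounded mg hBg fi.
have i2 := integrableM_bounded mf hBf gi.
split; first by have := @integrableD _ _ _ mu _ (mI 1) _ _ i1 i2.
move=> s s01; rewrite RintegralD//; [|exact: integrable_sub01..].
have T := integral_triangle s01 fi gi.
pose F x := \int[mu]_(y in `[0%R, x]) f' y; pose G x := \int[mu]_(y in `[0%R, x]) g' y.
have sx x : x \in (`[0%R, s]%classic : set R) -> 0 <= x <= 1.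
  by move=> /set_mem/(sub01 s01)/=; rewrite in_itv.
have GE x : x \in (`[0%R, s]%classic : set R) -> G x = g x - g 0.
  by move=> /sx x01; rewrite (gE x x01) addrAC subrr add0r.
have FE x : x \in (`[0%R, s]%classic : set R) -> F x = f x - f 0.
  by move=> /sx x01; rewrite (fE x x01) addrAC subrr add0r.
have fis := integrable_sub01 s01 fi; have gis := integrable_sub01 s01 gi.
have i1s := integrable_sub01 s01 i1; have i2s := integrable_sub01 s01 i2.
have e1 : \int[mu]_(x in `[0%R, s]) (f' x * G x) =
    \int[mu]_(x in `[0%R, s]) (f' x * g x) - g 0 * F s.
  rewrite -RintegralZl// -RintegralB//; last first.
    by have := @integrableZl _ _ _ mu _ (mI s) (g 0) _ fis.
  by apply: eq_Rintegral => x xs; rewrite GE//; ring.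
have e2 : \int[mu]_(x in `[0%R, s]) (g' x * (F s - F x)) =
    (F s + f 0) * G s - \int[mu]_(x in `[0%R, s]) (g' x * f x).
  rewrite -RintegralZl// -RintegralB//; last first.
    by have := @integrableZl _ _ _ mu _ (mI s) (F s + f 0) _ gis.
  by apply: eq_Rintegral => x xs; rewrite (FE x xs); ring.
have : \int[mu]_(x in `[0%R, s]) (f' x * G x) = \int[mu]_(x in `[0%R, s]) (g' x * (F s - F x)).
  by rewrite /Rintegral T.
rewrite e1 e2 => e3; rewrite (fE s s01) (gE s s01) -/(F s) -/(G s).
set X := \int[mu]_(x in _) (f' x * g x) in e3 *; set Y := \int[mu]_(x in _) (g' x * f x) in e3 *.
lra.
Qed.

(** This is how infinite sums are differentiated in [s]: partial sums are handled by [prim_sum], and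
    only an integrable bound on their derivatives is required. It serves both the cumulative sums
    and the power series of the flow. *)
Lemma prim_lim (f f' : nat -> R -> R) g g' (H : R -> R) :
  (forall n, prim (f n) (f' n)) ->
  (forall s, 0 <= s <= 1 -> f n s @[n --> \oo] --> g s) ->
  (forall s, 0 <= s <= 1 -> f' n s @[n --> \oo] --> g' s) ->
  mu.-integrable I01 (EFin \o H) ->
  (forall n s, 0 <= s <= 1 -> `|f' n s| <= H s) ->
  prim g g'.
Proof.
move=> pf fg fg' Hi fH.
have mf n : measurable_fun I01 (f' n).
  by apply/measurable_EFinP; have [fi _] := pf n; exact: measurable_int fi.
have mg : measurable_fun I01 g'.
  by apply: (measurable_fun_cvg mf) => x /=; rewrite in_itv/=; exact: fg'.
have dom s : 0 <= s <= 1 -> mu.-integrable `[0%R, s] (EFin \o g') /\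
    (\int[mu]_(x in `[0%R, s]) (f' n x)%:E @[n --> \oo] -->
     \int[mu]_(x in `[0%R, s]) (g' x)%:E)%E.
  move=> s01; have sub x : `[0%R, s]%classic x -> 0 <= x <= 1.
    by move/(sub01 s01); rewrite /= in_itv.
  have [] := @dominated_convergence _ _ _ mu _ (mI s)
    (fun n x => (f' n x)%:E) (EFin \o g') (EFin \o H).
  - move=> n; apply/measurable_EFinP.
    by apply: measurable_funS (mf n) => //; exact: sub01.
  - apply/measurable_EFinP.
    by apply: measurable_funS mg => //; exact: sub01.
  - by apply/aeW => x xs; apply: cvg_EFin; [near=> n|apply: fg'; exact: sub].
  - exact: integrable_sub01.
  - by apply/aeW => x n xs; rewrite /= lee_fin; apply: fH; exact: sub.
  by [].
apply: primP; first by apply: (dom 1 _).1; rewrite lexx ler01.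
move=> s s01; have [_ c1] := dom s s01.
have c2 : ((f n s - f n 0)%:E @[n --> \oo] --> (g s - g 0)%:E)%E.
  apply: cvg_EFin; first by near=> n.
  by apply: cvgB; apply: fg => //; rewrite lexx ler01.
apply: (cvg_unique _ c1) => //.
have -> : (fun n => \int[mu]_(x in `[0%R, s]) (f' n x)%:E)%E = (fun n => (f n s - f n 0)%:E).
  by apply/funext => n; rewrite (prim_integral (pf n) s01).
exact: c2.
Unshelve. all: by end_near. Qed.

End Primitives.

(** * Power series *)

Section GeometricSeries.
Variable R : realType.

Lemma geometric_cvg (c : nat -> R) (B q : R) : 0 <= q < 1 ->
  (forall n, `|c n| <= B * q ^+ n) -> cvgn (series c).
Proof.
move=> /andP[q0 q1] cB; apply: normed_cvg.
apply: (@series_le_cvg _ _ (geometric B q)) => //.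
- by move=> n /=; exact: normr_ge0.
- by move=> n; rewrite /geometric/=; apply: le_trans (cB n); exact: normr_ge0.
- by apply: is_cvg_geometric_series; rewrite ger0_norm.
Qed.

Lemma geometric_sum_le (c : nat -> R) (B q : R) N : 0 <= q <= 1 / 2 ->
  (forall n, `|c n| <= B * q ^+ n) -> `|\sum_(n < N) c n| <= 2 * B.
Proof.
move=> /andP[q0 q1] cB.
have B0 : 0 <= B by have := cB 0%N; rewrite expr0 mulr1; exact: le_trans.
apply: (le_trans (ler_norm_sum _ _ _)).
apply: (@le_trans _ _ (\sum_(n < N) B * q ^+ n)); first exact: ler_sum.
rewrite -mulr_sumr mulrC ler_wpM2r//.
(* The subtracted power makes the induction close: its step amounts to [2 * q <= 1]. *)
suff : \sum_(n < N) q ^+ n <= 2 - 2 * q ^+ N.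
  by move=> /le_trans; apply; rewrite gerBl mulr_ge0// exprn_ge0.
elim: N => [|N IH]; first by rewrite big_ord0 expr0; lra.
rewrite big_ord_recr/= exprS; have := exprn_ge0 N q0; nra.
Qed.

Lemma geometric_lim_le (c : nat -> R) (B q : R) : 0 <= q <= 1 / 2 ->
  (forall n, `|c n| <= B * q ^+ n) -> `|limn (series c)| <= 2 * B.
Proof.
move=> q01 cB; have q1 : 0 <= q < 1 by lra.
have cc := geometric_cvg q1 cB.
have cn : `|series c n| @[n --> \oo] --> `|limn (series c)| .
  exact: cvg_norm cc.
rewrite -(cvg_lim (@Rhausdorff R) cn); apply: limr_le.
  by apply/cvg_ex; eexists; exact: cn.
by near=> n; rewrite /series/= big_mkord; exact: geometric_sum_le q01 cB.
Unshelve. all: by end_near. Qed.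

Lemma natr_le_pow2 n : (n.+1%:R <= 2 ^+ n :> R).
Proof. by rewrite -natrX ler_nat; elim: n => // n IH; rewrite expnS; lia. Qed.

(** Convergence at [K] is needed for the series and for its first two formal derivatives. Each
    differentiation brings a factor at most [2 ^+ n], that is, doubles the geometric ratio, and
    [C * K <= 1 / 8] keeps even [4 * C * K] below 1. *)
Lemma pseries_is_derive (c : nat -> R) (B C K x : R) :
  0 <= C -> 0 < K -> C * K <= 1 / 8 -> (forall n, `|c n| <= B * C ^+ n) -> `|x| < K ->
  is_derive x 1 (fun x => limn (pseries c x)) (limn (pseries (pseries_diffs c) x)).
Proof.
move=> C0 K0 CK cB xK.
have B0 : 0 <= B by have := cB 0%N; rewrite expr0 mulr1; exact: le_trans.
have q0 : 0 <= C * K by rewrite mulr_ge0// ltW.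
apply: (@pseries_snd_diffs _ c K) => //.
- apply: (@geometric_cvg _ B (C * K)); first by lra.
  move=> n; rewrite normrM normrX (gtr0_norm K0) exprMn mulrA ler_wpM2r//.
  by rewrite exprn_ge0// ltW.
- apply: (@geometric_cvg _ (B * C) (2 * (C * K))); first by lra.
  move=> n; rewrite /pseries_diffs !normrM normrX (gtr0_norm K0).
  rewrite (ger0_norm (ler0n _ _)) !exprMn.
  apply: (@le_trans _ _ (2 ^+ n * (B * C ^+ n.+1) * K ^+ n)).
    rewrite ler_wpM2r ?exprn_ge0 ?(ltW K0)//.
    by apply: ler_pM => //; exact: natr_le_pow2.
  by rewrite exprS le_eqVlt; apply/orP; left; apply/eqP; ring.
- apply: (@geometric_cvg _ (2 * B * C ^+ 2) (4 * (C * K))); first by lra.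
  move=> n; rewrite /pseries_diffs !normrM normrX (gtr0_norm K0).
  rewrite !(ger0_norm (ler0n _ _)) !exprMn.
  apply: (@le_trans _ _ (2 ^+ n * (2 ^+ n.+1 * (B * C ^+ n.+2)) * K ^+ n)).
    rewrite ler_wpM2r ?exprn_ge0 ?(ltW K0)//.
    apply: ler_pM => //; first exact: natr_le_pow2.
    by apply: ler_pM => //; exact: natr_le_pow2.
  rewrite !exprS -[4]/(2 * 2)%:R natrM exprMn le_eqVlt; apply/orP; left; apply/eqP; ring.
- by rewrite (gtr0_norm K0).
Qed.

Lemma cauchy_partial (a b : nat -> R) N :
  \sum_(n < N) \sum_(i < n.+1) a i * b (n - i)%N =
  \sum_(i < N) a i * \sum_(j < N - i) b j.
Proof.
elim: N => [|N IH]; first by rewrite !big_ord0.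
rewrite big_ord_recr/= IH [in RHS]big_ord_recr/= subSnn big_ord1.
rewrite [X in _ + X = _]big_ord_recr/= subnn addrA -big_split/=; congr (_ + _).
apply: eq_bigr => i _; rewrite -mulrDr; congr (_ * _).
by rewrite subSn ?(ltnW (ltn_ord i))// big_ord_recr.
Qed.

Lemma cauchy_product (a b : nat -> R) (A B q : R) : 0 <= q <= 1 / 4 ->
  (forall n, `|a n| <= A * q ^+ n) -> (forall n, `|b n| <= B * q ^+ n) ->
  series (fun n => \sum_(i < n.+1) a i * b (n - i)%N) n @[n --> \oo] -->
  limn (series a) * limn (series b).
Proof.
move=> q01 aA bB; have q1 : 0 <= q < 1 by lra.
have [q0 _] := andP q1.
have A0 : 0 <= A by have := aA 0%N; rewrite expr0 mulr1; exact: le_trans.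
have B0 : 0 <= B by have := bB 0%N; rewrite expr0 mulr1; exact: le_trans.
have ca := geometric_cvg q1 aA; have cb := geometric_cvg q1 bB.
pose e N := series a N * series b N -
  series (fun n => \sum_(i < n.+1) a i * b (n - i)%N) N.
have eE N : e N = \sum_(i < N) a i * (\sum_(N - i <= j < N) b j).
  rewrite /e /series/= !big_mkord cauchy_partial mulr_suml -sumrB.
  apply: eq_bigr => i _; rewrite -mulrBr; congr (_ * _).
  rewrite -!(big_mkord xpredT) (@big_cat_nat _ _ _ (N - i)%N 0%N N)//= ?leq_subr//.
  by rewrite addrAC subrr add0r.
have tail m N : `|\sum_(m <= j < N) b j| <= (2 * B) * q ^+ m.
  rewrite -{1}[m]add0n big_addn big_mkord.
  have h : 0 <= q <= 1 / 2 by lra.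
  rewrite -mulrA; apply: (@geometric_sum_le (fun i => b (i + m)%N) _ q) => // n; apply: (le_trans (bB _)).
  by rewrite exprD mulrA mulrAC.
(* Each of the [N] terms of [eE] is at most [2 * A * B * q ^+ N], because [a i] contributes [q ^+ i]
   and the tail of [b] from [N - i] on contributes [q ^+ (N - i)]. The count [N <= 2 ^+ N] is
   absorbed by doubling the ratio. *)
have eB N : `|e N| <= geometric (2 * A * B) (2 * q) N.
  rewrite eE; apply: (le_trans (ler_norm_sum _ _ _)).
  apply: (@le_trans _ _ (\sum_(i < N) 2 * A * B * q ^+ N)).
    apply: ler_sum => i _; rewrite normrM.
    apply: (@le_trans _ _ ((A * q ^+ i) * ((2 * B) * q ^+ (N - i)))).
      by apply: ler_pM.
    have -> : q ^+ N = q ^+ i * q ^+ (N - i) by rewrite -exprD subnKC// ltnW.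
    by rewrite le_eqVlt; apply/orP; left; apply/eqP; ring.
  rewrite sumr_const card_ord /geometric/= -[X in X <= _]mulr_natr exprMn -!mulrA.
  rewrite !ler_wpM2l// mulrC ler_wpM2r ?exprn_ge0//.
  by apply: (le_trans _ (natr_le_pow2 N)); rewrite ler_nat.
have e0 : e N @[N --> \oo] --> (0 : R).
  have g0 : geometric (2 * A * B) (2 * q) N @[N --> \oo] --> (0 : R).
    by apply: cvg_geometric; rewrite ger0_norm; lra.
  apply: (@norm_cvg0 _ R); apply: (squeeze_cvgr _ (cvg_cst (0 : R)) g0).
  by near=> N; rewrite normr_ge0/=; exact: eB.
have -> : series (fun n => \sum_(i < n.+1) a i * b (n - i)%N) =
   (fun N => series a N * series b N - e N).
  by apply/funext => N; rewrite /e opprB addrC subrK.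
rewrite -[X in _ --> X]subr0; apply: (@cvgB _ (R : normedModType R)) => //.
by apply: cvgM.
Unshelve. all: by end_near. Qed.

Lemma mvt_bound (f df : R -> R) (a b B : R) : a <= b ->
  (forall x, a < x < b -> is_derive x 1 f (df x)) ->
  {within `[a, b], continuous f} ->
  (forall x, a < x < b -> `|df x| <= B) -> `|f b - f a| <= B * (b - a).
Proof.
rewrite le_eqVlt => /orP[/eqP->|ab] fd fc fB; first by rewrite !subrr normr0 mulr0.
have fd' x : x \in `]a, b[ -> is_derive x 1 f (df x) by rewrite in_itv/=; exact: fd.
have [c] := MVT ab fd' fc.
rewrite in_itv/= => cab ->; rewrite normrM (@gtr0_norm _ (b - a)) ?subr_gt0//.
by rewrite ler_wpM2r ?subr_ge0 ?(ltW ab)// fB.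
Qed.

End GeometricSeries.

(** * Analytic local solutions *)

Section CourseOfValues.
Variables (T : Type) (x0 : T) (step : nat -> (nat -> T) -> T).

(** A Cauchy product involves all earlier Taylor coefficients, so the recursion carries the table of
    values computed so far instead of the last value alone. *)
Fixpoint cov_table (n : nat) : nat -> T :=
  if n is m.+1 then fun i => if i == m.+1 then step m (cov_table m) else cov_table m i
  else fun=> x0.

Definition cov_rec (n : nat) : T := cov_table n n.

Lemma cov_tableE n i : (i <= n)%N -> cov_table n i = cov_rec i.
Proof.
elim: n => [|n IH]; first by rewrite leqn0 => /eqP->.
rewrite leq_eqVlt => /predU1P[->//|]; rewrite ltnS => ni /=.
by rewrite ltn_eqF ?ltnS// IH.
Qed.

Lemma cov_recS n :
  (forall f g, (forall i, (i <= n)%N -> f i = g i) -> step n f = step n g) ->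
  cov_rec n.+1 = step n cov_rec.
Proof.
move=> ext; rewrite /cov_rec/= eqxx; apply: ext => i ni.
exact: cov_tableE.
Qed.

End CourseOfValues.

Section DiscreteLaplacian.
Variables (R : realType) (delta : R).
Hypothesis d0 : 0 < delta.

Lemma lapd_norm (f : int -> R) k :
  `|lapd delta f k| <= (`|f (k + 1)| + `|f (k - 1)| + 2 * `|f k|) / delta ^+ 2.
Proof.
rewrite /lapd normrM normfV (ger0_norm (exprn_ge0 2 (ltW d0))).
rewrite ler_wpM2r ?invr_ge0 ?exprn_ge0 ?(ltW d0)//.
apply: (le_trans (ler_normB _ _)); rewrite normrM (@ger0_norm _ 2)//.
by rewrite lerD2r ler_normD.
Qed.

Lemma lapd_le (f : int -> R) k B : (forall j, `|f j| <= B) ->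
  `|lapd delta f k| <= 4 * B / delta ^+ 2.
Proof.
move=> fB; apply: (le_trans (lapd_norm f k)).
rewrite ler_wpM2r ?invr_ge0 ?exprn_ge0 ?(ltW d0)//.
have := fB (k + 1); have := fB (k - 1); have := fB k; lra.
Qed.

Lemma lapd_sum n (f : 'I_n -> int -> R) k :
  \sum_(i < n) lapd delta (f i) k = lapd delta (fun j => \sum_(i < n) f i j) k.
Proof.
rewrite /lapd -mulr_suml; congr (_ / _).
by rewrite sumrB big_split/= mulr_sumr.
Qed.

Lemma lapdZ c (f : int -> R) k : lapd delta (fun j => c * f j) k = c * lapd delta f k.
Proof. by rewrite /lapd; ring. Qed.

Lemma lapdB (f g : int -> R) k :
  lapd delta (fun j => f j - g j) k = lapd delta f k - lapd delta g k.
Proof. by rewrite /lapd; ring. Qed.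

Lemma cvg_lapd (f : nat -> int -> R) (l : int -> R) k :
  (forall j, f n j @[n --> \oo] --> l j) ->
  lapd delta (f n) k @[n --> \oo] --> lapd delta l k.
Proof.
move=> fl; rewrite /lapd; apply: cvgM; last exact: cvg_cst.
apply: (@cvgB _ (R : normedModType R)); first by apply: (@cvgD _ (R : normedModType R)).
by apply: cvgM => //; exact: cvg_cst.
Qed.

End DiscreteLaplacian.

Section PowerSeriesFlow.
Variables (R : realType) (delta M : R).
Implicit Types (rho w : int -> R) (t x : R) (k : int).
Hypotheses (d0 : 0 < delta) (M0 : 0 < M).

(** The 12 is 2 * 6 in the linearised equation: its factor 2, and a laplacian of at most
    [6 * m k / delta ^+ 2] when the weight [m] at most doubles between neighbours. It is also 4 * 3
    in [aflow_unique], from the laplacian of a difference of squares. *)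
Definition rate : R := 12 * M / delta ^+ 2.

(* Taylor coefficients in time of the solutions of [a' = lapd (a ^ 2)], [a 0 = rho]
   and of its linearisation [u' = 2 a lapd u], [u 0 = w]. *)
Definition acoef (rho : int -> R) : nat -> int -> R :=
  cov_rec rho (fun n f k => n.+1%:R^-1 *
    lapd delta (fun j => \sum_(i < n.+1) f i j * f (n - i)%N j) k).

Definition ucoef (rho w : int -> R) : nat -> int -> R :=
  cov_rec w (fun n f k => n.+1%:R^-1 *
    (2 * \sum_(i < n.+1) acoef rho i k * lapd delta (f (n - i)%N) k)).

Lemma acoefS rho n k : n.+1%:R * acoef rho n.+1 k =
  lapd delta (fun j => \sum_(i < n.+1) acoef rho i j * acoef rho (n - i)%N j) k.
Proof.
rewrite {1}/acoef cov_recS.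
  by rewrite mulVKf ?pnatr_eq0.
move=> f g fg; apply/funext => j; congr (_ * lapd _ _ _); apply/funext => l.
by apply: eq_bigr => i _; rewrite !fg ?leq_subr// -ltnS.
Qed.

Lemma ucoefS rho w n k : n.+1%:R * ucoef rho w n.+1 k =
  2 * \sum_(i < n.+1) acoef rho i k * lapd delta (ucoef rho w (n - i)%N) k.
Proof.
rewrite {1}/ucoef cov_recS.
  by rewrite mulVKf ?pnatr_eq0.
move=> f g fg; apply/funext => j; congr (_ * (_ * _)).
by apply: eq_bigr => i _; rewrite !fg ?leq_subr.
Qed.

Let rate0 : 0 < rate.
Proof. by rewrite /rate divr_gt0 ?exprn_gt0// mulr_gt0. Qed.

Let dd0 : 0 <= (delta ^+ 2)^-1.
Proof. by rewrite invr_ge0 exprn_ge0// ltW. Qed.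

(** The [n.+1] terms of the Cauchy product cancel the factor [n.+1] of [acoefS], and each of them
    carries [rate ^+ i * rate ^+ (n - i)]; hence the growth is geometric with a ratio independent of
    [k]. *)
Lemma acoef_le rho : (forall k, `|rho k| <= M) ->
  forall n k, `|acoef rho n k| <= M * rate ^+ n.
Proof.
move=> rM n; elim/ltn_ind: n => -[|n] IH k; first by rewrite expr0 mulr1; exact: rM.
rewrite -(@ler_pM2l _ n.+1%:R) ?ltr0n// -{1}(@ger0_norm _ n.+1%:R)// -normrM acoefS.
apply: (@le_trans _ _ (4 * (n.+1%:R * (M ^+ 2 * rate ^+ n)) / delta ^+ 2)).
  apply: lapd_le => // j; apply: (le_trans (ler_norm_sum _ _ _)).
  rewrite mulr_natl -[X in _ <= _ *+ X]card_ord -sumr_const; apply: ler_sum => i _.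
  rewrite normrM.
  have -> : M ^+ 2 * rate ^+ n = (M * rate ^+ i) * (M * rate ^+ (n - i)).
    by rewrite mulrACA -exprD subnKC ?expr2// -ltnS.
  by apply: ler_pM => //; apply: IH; rewrite ltnS ?leq_subr// -ltnS.
have p := exprn_ge0 n (ltW rate0).
have -> : rate ^+ n.+1 = 12 * M / delta ^+ 2 * rate ^+ n by rewrite exprS.
have : 0 <= n.+1%:R * M ^+ 2 * rate ^+ n * (delta ^+ 2)^-1.
  by rewrite !mulr_ge0// ltW.
lra.
Qed.

(* The weight [m] varies slowly, so that the bound also controls the neighbours
   of [k]; it is this local bound that makes [u] square summable. *)
Lemma ucoef_le rho w (m : int -> R) : (forall k, `|rho k| <= M) ->
  (forall k, `|w k| <= m k) ->
  (forall k, m (k + 1) <= 2 * m k) -> (forall k, m (k - 1) <= 2 * m k) ->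
  forall n k, `|ucoef rho w n k| <= m k * rate ^+ n.
Proof.
move=> rM wm mp mn n; elim/ltn_ind: n => -[|n] IH k; first by rewrite expr0 mulr1; exact: wm.
have m0 j : 0 <= m j by exact: le_trans (wm j).
rewrite -(@ler_pM2l _ n.+1%:R) ?ltr0n// -{1}(@ger0_norm _ n.+1%:R)// -normrM ucoefS.
rewrite normrM (@ger0_norm _ 2)//.
apply: (@le_trans _ _ (2 * (n.+1%:R * (6 * M * m k / delta ^+ 2 * rate ^+ n)))).
  rewrite ler_wpM2l//; apply: (le_trans (ler_norm_sum _ _ _)).
  rewrite mulr_natl -[X in _ <= _ *+ X]card_ord -sumr_const; apply: ler_sum => i _.
  rewrite normrM.
  have -> : 6 * M * m k / delta ^+ 2 * rate ^+ n =
      (M * rate ^+ i) * ((6 * m k / delta ^+ 2) * rate ^+ (n - i)).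
    have -> : rate ^+ n = rate ^+ i * rate ^+ (n - i) by rewrite -exprD subnKC// -ltnS.
    by ring.
  apply: ler_pM => //; first exact: acoef_le.
  apply: (le_trans (lapd_norm d0 _ _)); rewrite mulrAC ler_wpM2r//.
  have l : (n - i < n.+1)%N by rewrite ltnS leq_subr.
  have p := exprn_ge0 (n - i) (ltW rate0).
  have := IH _ l k; have := IH _ l (k + 1); have := IH _ l (k - 1).
  have := ler_wpM2r p (mp k); have := ler_wpM2r p (mn k); lra.
have -> : rate ^+ n.+1 = 12 * M / delta ^+ 2 * rate ^+ n by rewrite exprS.
by rewrite le_eqVlt; apply/orP; left; apply/eqP; ring.
Qed.

Definition aflow (rho : int -> R) (t : R) (k : int) : R :=
  limn (pseries (acoef rho ^~ k) t).

Definition uflow (rho w : int -> R) (t : R) (k : int) : R :=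
  limn (pseries (ucoef rho w ^~ k) t).

Lemma geometric_scale (c : nat -> R) B t : (forall n, `|c n| <= B * rate ^+ n) ->
  forall n, `|c n * t ^+ n| <= B * (rate * `|t|) ^+ n.
Proof.
by move=> cB n; rewrite normrM normrX exprMn mulrA ler_wpM2r.
Qed.

Variable rho : int -> R.
Hypothesis rM : forall k, `|rho k| <= M.

Let small (t : R) : rate * `|t| <= 1 / 8 -> 0 <= rate * `|t| <= 1 / 4.
Proof. by move=> h; rewrite mulr_ge0 ?(ltW rate0)//=; lra. Qed.

Lemma aflow_cvg t k : rate * `|t| <= 1 / 8 ->
  pseries (acoef rho ^~ k) t n @[n --> \oo] --> aflow rho t k.
Proof.
move=> /small q; apply: (@geometric_cvg _ _ M (rate * `|t|)); first by lra.
by apply: geometric_scale; move=> n; exact: acoef_le.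
Qed.

Lemma aflow0 k : aflow rho 0 k = rho k.
Proof.
rewrite /aflow; apply: cvg_lim => //; rewrite -(cvg_shiftS (pseries _ _)).
apply: cvg_near_cst; near=> n; rewrite /pseries/= /series/= big_nat_recl//= expr0 mulr1.
by rewrite big1 ?addr0// => i _; rewrite expr0n/= mulr0.
Unshelve. all: by end_near. Qed.

Lemma aflow_le t k : rate * `|t| <= 1 / 8 -> `|aflow rho t k| <= 2 * M.
Proof.
move=> /small q; apply: (@geometric_lim_le _ _ _ (rate * `|t|)); first by lra.
by apply: geometric_scale; move=> n; exact: acoef_le.
Qed.

Lemma adiffs_cvg t k : rate * `|t| <= 1 / 8 ->
  pseries (pseries_diffs (acoef rho ^~ k)) t n @[n --> \oo] -->
  lapd delta (sqz (aflow rho t)) k.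
Proof.
move=> /small q.
(* The Cauchy product squares the series; [acoefS] then recognises the laplacian of its terms as the
   formally differentiated series. *)
have c j : series (fun n => \sum_(i < n.+1) (acoef rho i j * t ^+ i) *
     (acoef rho (n - i)%N j * t ^+ (n - i))) n @[n --> \oo] --> sqz (aflow rho t) j.
  rewrite /sqz expr2 /aflow.
  apply: (@cauchy_product _ (fun n => acoef rho n j * t ^+ n) (fun n => acoef rho n j * t ^+ n) M M (rate * `|t|)) => //.
    by apply: geometric_scale; move=> n; exact: acoef_le.
  by apply: geometric_scale; move=> n; exact: acoef_le.
have := @cvg_lapd _ delta _ _ k c; apply: cvg_trans; apply: near_eq_cvg; near=> n.
rewrite /pseries /series/= big_mkord.
transitivity (\sum_(i < n) lapd delta (fun j => \sum_(l < i.+1)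
   (acoef rho l j * t ^+ l) * (acoef rho (i - l)%N j * t ^+ (i - l))) k).
  rewrite lapd_sum; congr (lapd _ _ _); apply/funext => j.
  by rewrite big_mkord.
apply: eq_bigr => i _; rewrite /pseries_diffs acoefS mulrC -lapdZ; congr (lapd _ _ _).
apply/funext => j; rewrite mulr_sumr; apply: eq_bigr => l _.
have -> : t ^+ i = t ^+ l * t ^+ (i - l) by rewrite -exprD subnKC// -ltnS.
by ring.
Unshelve. all: by end_near. Qed.

Lemma aflow_derive t k : rate * `|t| < 1 / 8 ->
  is_derive t (1 : R) (fun t => aflow rho t k) (lapd delta (sqz (aflow rho t)) k).
Proof.
move=> h; rewrite -(cvg_lim _ (@adiffs_cvg t k (ltW h)))//.
apply: (@pseries_is_derive _ _ M rate (8 * rate)^-1) => //.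
- exact: ltW.
- by rewrite invr_gt0 mulr_gt0.
- by rewrite invfM mulrCA mulfV ?gt_eqF// mulr1 div1r.
- by move=> n; exact: acoef_le.
- by rewrite invfM -div1r ltr_pdivlMr// mulrC div1r -div1r.
Qed.

Section Linearised.
Variables w m : int -> R.
Hypotheses (wm : forall k, `|w k| <= m k)
  (mp : forall k, m (k + 1) <= 2 * m k) (mn : forall k, m (k - 1) <= 2 * m k).

Lemma uflow_cvg t k : rate * `|t| <= 1 / 8 ->
  pseries (ucoef rho w ^~ k) t n @[n --> \oo] --> uflow rho w t k.
Proof.
move=> /small q; apply: (@geometric_cvg _ _ (m k) (rate * `|t|)); first by lra.
by apply: geometric_scale; move=> n; exact: ucoef_le.
Qed.

Lemma uflow0 k : uflow rho w 0 k = w k.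
Proof.
rewrite /uflow; apply: cvg_lim => //; rewrite -(cvg_shiftS (pseries _ _)).
apply: cvg_near_cst; near=> n; rewrite /pseries/= /series/= big_nat_recl//= expr0 mulr1.
by rewrite big1 ?addr0// => i _; rewrite expr0n/= mulr0.
Unshelve. all: by end_near. Qed.

Lemma uflow_le t k : rate * `|t| <= 1 / 8 -> `|uflow rho w t k| <= 2 * m k.
Proof.
move=> /small q; apply: (@geometric_lim_le _ _ _ (rate * `|t|)); first by lra.
by apply: geometric_scale; move=> n; exact: ucoef_le.
Qed.

Lemma lapd_ucoef_le n k :
  `|lapd delta (ucoef rho w n) k| <= 6 * m k / delta ^+ 2 * rate ^+ n.
Proof.
apply: (le_trans (lapd_norm d0 _ _)); rewrite mulrAC ler_wpM2r//.
have p := exprn_ge0 n (ltW rate0).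
have l := ucoef_le rM wm mp mn n.
have := l k; have := l (k + 1); have := l (k - 1).
have := ler_wpM2r p (mp k); have := ler_wpM2r p (mn k); lra.
Qed.

Lemma udiffs_cvg t k : rate * `|t| <= 1 / 8 ->
  pseries (pseries_diffs (ucoef rho w ^~ k)) t n @[n --> \oo] -->
  2 * (aflow rho t k * lapd delta (uflow rho w t) k).
Proof.
move=> h; have q := small h.
pose b n := lapd delta (ucoef rho w n) k * t ^+ n.
have bl : series b n @[n --> \oo] --> lapd delta (uflow rho w t) k.
  have := @cvg_lapd _ delta _ _ k (fun j => @uflow_cvg t j h).
  apply: cvg_trans; apply: near_eq_cvg; near=> n.
  rewrite /pseries /series/= [RHS]big_mkord /b.
  transitivity (lapd delta (fun j => \sum_(i < n) ucoef rho w i j * t ^+ i) k).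
    by congr (lapd _ _ _); apply/funext => j; rewrite big_mkord.
  rewrite -lapd_sum; apply: eq_bigr => i _; rewrite mulrC -lapdZ; congr (lapd _ _ _).
  by apply/funext => j; rewrite mulrC.
rewrite -(cvg_lim _ bl)//.
have c := @cauchy_product _ (fun n => acoef rho n k * t ^+ n) b M (6 * m k / delta ^+ 2) (rate * `|t|) q.
have {}c : series (fun n => \sum_(i < n.+1) (acoef rho i k * t ^+ i) * b (n - i)%N) n @[n --> \oo]
    --> aflow rho t k * limn (series b).
  apply: c; apply: geometric_scale; first by move=> n; exact: acoef_le.
  by move=> n; exact: lapd_ucoef_le.
have c2 : 2 * series (fun n => \sum_(i < n.+1) (acoef rho i k * t ^+ i) * b (n - i)%N) n
    @[n --> \oo] --> 2 * (aflow rho t k * limn (series b)).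
  by apply: cvgM => //; exact: cvg_cst.
move: c2; apply: cvg_trans; apply: near_eq_cvg; near=> n.
rewrite /pseries /series/= mulr_sumr; apply: eq_bigr => i _.
rewrite /pseries_diffs ucoefS -mulrA mulr_suml; congr (_ * _); apply: eq_bigr => l _.
have -> : t ^+ i = t ^+ l * t ^+ (i - l) by rewrite -exprD subnKC// -ltnS.
by rewrite /b; ring.
Unshelve. all: by end_near. Qed.

Lemma uflow_derive t k : rate * `|t| < 1 / 8 ->
  is_derive t (1 : R) (fun t => uflow rho w t k)
    (2 * (aflow rho t k * lapd delta (uflow rho w t) k)).
Proof.
move=> h; rewrite -(cvg_lim _ (@udiffs_cvg t k (ltW h)))//.
apply: (@pseries_is_derive _ _ (m k) rate (8 * rate)^-1) => //.
- exact: ltW.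
- by rewrite invr_gt0 mulr_gt0.
- by rewrite invfM mulrCA mulfV ?gt_eqF// mulr1 div1r.
- by move=> n; exact: ucoef_le.
- by rewrite invfM -div1r ltr_pdivlMr// mulrC div1r -div1r.
Qed.

End Linearised.

(** Gronwall by iteration. A bound [B] on the difference, uniform in [t] and [k], gives a derivative
    of size at most [rate * B], since [|y + aflow| <= M + 2 * M]. Integrating over a time at most
    [T] gives [B / 16], so the bound can be halved indefinitely, starting from [3 * M]. *)
Lemma aflow_unique (y : R -> int -> R) (T : R) : rate * T <= 1 / 16 ->
  (forall t k, 0 <= t <= T -> `|y t k| <= M) -> (forall k, y 0 k = rho k) ->
  (forall k, {within `[0%R, T], continuous (fun t => y t k)}) ->
  (forall k t, 0 < t < T -> is_derive t (1 : R) (fun t => y t k) (lapd delta (sqz (y t)) k)) ->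
  forall t k, 0 <= t <= T -> y t k = aflow rho t k.
Proof.
move=> rT yM y0 yc yd.
have rt t : 0 <= t <= T -> rate * `|t| <= 1 / 16.
  move=> /andP[t0 tT]; rewrite (ger0_norm t0); apply: le_trans rT.
  by rewrite ler_wpM2l// ltW.
have bnd j : forall t k, 0 <= t <= T -> `|y t k - aflow rho t k| <= 3 * M * (1 / 2) ^+ j.
  elim: j => [|j IH] t k tT.
    rewrite expr0 mulr1; apply: (le_trans (ler_normB _ _)).
    have := yM t k tT; have : rate * `|t| <= 1 / 8 by have := rt t tT; lra.
    by move=> /(aflow_le k); lra.
  have [t0 tT'] := andP tT.
  have sub x : 0 < x < t -> 0 < x < T by move=> /andP[-> /lt_le_trans]; apply.
  pose f x := y x k - aflow rho x k.
  pose df x := lapd delta (sqz (y x)) k - lapd delta (sqz (aflow rho x)) k.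
  have fd x : 0 < x < t -> is_derive x (1 : R) f (df x).
    move=> xt; have [x0 xT] := andP (sub _ xt).
    apply: is_deriveB; first exact: yd (sub _ xt).
    apply: aflow_derive; have := rt x; rewrite (ltW x0) (ltW xT) => /(_ isT); lra.
  have fc : {within `[0%R, t], continuous f}.
    have sb : (`[0%R, t] : set R) `<=` `[0%R, T] by apply: subset_itvl; rewrite bnd_simp.
    have c1 := continuous_subspaceW sb (yc k).
    have c2 : {within `[0%R, t], continuous (fun x => aflow rho x k)}.
      apply: derivable_within_continuous => x; rewrite in_itv/= => /andP[x0 xt].
      have hx : rate * `|x| < 1 / 8.
        by have := rt x; rewrite x0 (le_trans xt tT') => /(_ isT); lra.
      by have [] := @aflow_derive x k hx.
    by move=> x; apply: (@cvgB _ (R : normedModType R)); [exact: c1|exact: c2].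
  have dfB x : 0 < x < t -> `|df x| <= rate * (3 * M * (1 / 2) ^+ j).
    move=> xt; have [x0 xT] := andP (sub _ xt).
    have xT' : 0 <= x <= T by rewrite (ltW x0) (ltW xT).
    rewrite /df -lapdB.
    apply: (@le_trans _ _ (4 * (3 * M * (3 * M * (1 / 2) ^+ j)) / delta ^+ 2)).
      apply: lapd_le => // l; rewrite /sqz subr_sqr normrM mulrC.
      apply: ler_pM => //; last exact: IH.
      apply: (le_trans (ler_normD _ _)).
      have := yM x l xT'; have : rate * `|x| <= 1 / 8 by have := rt x xT'; lra.
      by move=> /(aflow_le l); lra.
    by rewrite {1}/rate le_eqVlt; apply/orP; left; apply/eqP; ring.
  have := mvt_bound t0 fd fc dfB.
  rewrite /f y0 aflow0 subrr !subr0 => /le_trans; apply.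
  have := rt t tT; rewrite (ger0_norm t0) exprS.
  have : 0 <= 3 * M * (1 / 2) ^+ j by rewrite !mulr_ge0 ?exprn_ge0// ltW.
  set X := (1 / 2) ^+ j; nra.
move=> t k tT; apply/eqP; rewrite -subr_eq0 -normr_le0.
have g0 : geometric (3 * M) (1 / 2) j @[j --> \oo] --> (0 : R).
  by apply: cvg_geometric; rewrite ger0_norm; lra.
rewrite -(cvg_lim (@Rhausdorff R) g0); apply: limr_ge; first by apply/cvg_ex; eexists; exact: g0.
by near=> j; exact: bnd.
Unshelve. all: by end_near. Qed.

End PowerSeriesFlow.

(** * Contraction of the linearised flow *)

Section Domination.
Variable R : realType.

Lemma esum_swap (a : int -> int -> \bar R) : (forall i j, (0 <= a i j)%E) ->
  (\esum_(i in [set: int]) \esum_(j in [set: int]) a i j =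
   \esum_(j in [set: int]) \esum_(i in [set: int]) a i j)%E.
Proof.
move=> a0; rewrite (@esum_esum _ _ _ setT (fun=> setT) a)// (@esum_esum _ _ _ setT (fun=> setT) (fun j i => a i j))//.
rewrite (@reindex_esum _ _ _ ([set: int] `*`` (fun=> setT)) _ (fun p => (p.2, p.1)))//=.
split=> //; first by move=> [x1 x2] [y1 y2] _ _ [-> ->].
by move=> [x1 x2] _; exists (x2, x1).
Qed.

Let q (j k : int) : R := (1 / 4) ^+ `|j - k|%N.

Let q0 j k : 0 <= q j k. Proof. by rewrite exprn_ge0//; lra. Qed.
Let q1 j k : q j k <= 1. Proof. by rewrite exprn_ile1//; lra. Qed.

Let q_shift j k l : (`|k - l| <= 1)%N -> q j l <= 4 * q j k.
Proof.
move=> kl.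
have -> : q j l = 4 * (1 / 4) ^+ (`|j - l|%N).+1 by rewrite exprS mulrA /q; lra.
rewrite ler_wpM2l//; apply: ler_wiXn2l; [lra|lra|lia].
Qed.

Let qsum_le j : (\esum_(k in [set: int]) (q j k)%:E <= 4%:E)%E.
Proof.
rewrite (@reindex_esum _ _ _ [set: int] _ (fun k => j - k)); last first.
  split=> //; first by move=> x y _ _ /=; lia.
  by move=> x _; exists (j - x) => //=; lia.
rewrite esum_int; last by move=> k; rewrite lee_fin.
apply: lime_le; first by apply: is_cvg_nneseries => n _ _; rewrite -EFinD lee_fin addr_ge0.
near=> N; rewrite -[leLHS]/(\sum_(0 <= n < N) ((q j (j - Posz n))%:E + (q j (j - Negz n))%:E))%E.
rewrite big_mkord sumEFin lee_fin.
apply: (@le_trans _ _ (\sum_(n < N) (2 * (1 / 4) ^+ n))).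
  apply: ler_sum => n _; rewrite /q.
  have -> : `|(j - (j - Posz n))%R|%N = n by lia.
  have -> : `|(j - (j - Negz n))%R|%N = n.+1 by lia.
  have p : 0 <= (1 / 4 : R) ^+ n by apply: exprn_ge0; lra.
  by rewrite exprS; lra.
have := @geometric_sum_le R (fun n => 2 * (1 / 4) ^+ n) 2 (1 / 4) N.
have := ler_norm (\sum_(n < N) (2 * (1 / 4) ^+ n : R)) => h1 h2.
apply: (le_trans h1); apply: (le_trans (h2 _ _)); [lra| |lra].
by move=> n; rewrite ger0_norm// mulr_ge0// exprn_ge0//; lra.
Unshelve. all: by end_near. Qed.

(** The majorant is the square root of [w ^+ 2] convolved with the kernel [4^(-|j - k|)]. The
    convolution changes by a factor at most 4 between neighbours, so its root changes by at most 2;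
    the diagonal term of the kernel gives domination, and summability of the kernel gives
    summability of the squares. *)
Lemma sq_majorant (w : int -> R) :
  (\esum_(k in [set: int]) ((w k) ^+ 2)%:E < +oo)%E ->
  exists m : int -> R, [/\ forall k, `|w k| <= m k,
    forall k, m (k + 1) <= 2 * m k, forall k, m (k - 1) <= 2 * m k &
    (\esum_(k in [set: int]) ((m k) ^+ 2)%:E < +oo)%E].
Proof.
move=> wfin.
pose G k := (\esum_(j in [set: int]) (q j k * w j ^+ 2)%:E)%E.
have t0 j k : (0 <= (q j k * w j ^+ 2)%:E)%E by rewrite lee_fin mulr_ge0// sqr_ge0.
have G0 k : (0 <= G k)%E by apply: esum_ge0.
have Gfin k : G k \is a fin_num.
  rewrite ge0_fin_numE//; apply: le_lt_trans wfin; apply: le_esum => j _.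
  by rewrite lee_fin ler_piMl// sqr_ge0.
pose g k := fine (G k).
have gE k : (g k)%:E = G k by rewrite fineK.
have g0 k : 0 <= g k by rewrite fine_ge0.
have gs k l : (`|k - l| <= 1)%N -> g l <= 4 * g k.
  move=> kl; rewrite -lee_fin EFinM !gE /G.
  rewrite -esum_intZl//.
  apply: le_esum => j _; rewrite -EFinM lee_fin.
  by have := q_shift j kl; have := sqr_ge0 (w j); nra.
have sq4 x y : 0 <= x -> 0 <= y -> x <= 4 * y -> Num.sqrt x <= 2 * Num.sqrt y.
  move=> x0 y0 xy; rewrite -[2]ger0_norm// -sqrtr_sqr -sqrtrM ?sqr_ge0// ler_wsqrtr//.
  by rewrite expr2; lra.
exists (fun k => Num.sqrt (g k)); split=> [k|k|k|].
- rewrite -sqrtr_sqr ler_wsqrtr// -lee_fin gE.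
  have -> : w k ^+ 2 = q k k * w k ^+ 2 by rewrite /q subrr expr0 mul1r.
  by apply: (@term_le_esum _ (fun j => q j k * w j ^+ 2)) => j; rewrite mulr_ge0// sqr_ge0.
- by apply: sq4 => //; apply: gs; lia.
- by apply: sq4 => //; apply: gs; lia.
- under eq_esum do rewrite sqr_sqrtr// gE.
  rewrite /G esum_swap//.
  apply: (@le_lt_trans _ _ (\esum_(j in [set: int]) (4 * w j ^+ 2)%:E)%E).
    apply: le_esum => j _.
    under eq_esum do rewrite mulrC EFinM.
    rewrite esum_intZl ?sqr_ge0//; last by move=> k; rewrite lee_fin.
    have -> : (4 * w j ^+ 2)%:E = ((w j ^+ 2)%:E * 4%:E)%E by rewrite -EFinM mulrC.
    by apply: lee_wpmul2l (qsum_le j); rewrite lee_fin sqr_ge0.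
  under eq_esum do rewrite EFinM.
  rewrite esum_intZl//; last by move=> k; rewrite lee_fin sqr_ge0.
  by rewrite lte_mul_pinfty.
Qed.

End Domination.

Section FluxSum.
Variables (R : realType) (w v r : int -> R).
Hypothesis wvr : forall k, w k = v k * r k.

(** With [w] in the role of [U] and [v = U / rho], the time derivative of [U^2 / rho] is
    [4 U lapd U - v^2 lapd (rho^2)]. Up to [delta ^+ 2], [fluxR] and [fluxL] are its parts on the
    two edges at [k]. *)
Let fluxR k := 4 * w k * (w (k + 1) - w k) - v k ^+ 2 * (r (k + 1) ^+ 2 - r k ^+ 2).
Let fluxL k := 4 * w k * (w (k - 1) - w k) - v k ^+ 2 * (r (k - 1) ^+ 2 - r k ^+ 2).

(* The edge term equals -(3 (w - w')^2 + (v' r - v r')^2). *)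
Let edge k l : l = k + 1 -> fluxR k + fluxL l <= 0.
Proof.
move=> ->; rewrite /fluxR /fluxL addrK !wvr.
set v1 := v k; set v2 := v (k + 1); set r1 := r k; set r2 := r (k + 1).
have -> : 4 * (v1 * r1) * (v2 * r2 - v1 * r1) - v1 ^+ 2 * (r2 ^+ 2 - r1 ^+ 2) +
  (4 * (v2 * r2) * (v1 * r1 - v2 * r2) - v2 ^+ 2 * (r1 ^+ 2 - r2 ^+ 2)) =
  - (3 * (v1 * r1 - v2 * r2) ^+ 2 + (v2 * r1 - v1 * r2) ^+ 2) by ring.
have := sqr_ge0 (v1 * r1 - v2 * r2); have := sqr_ge0 (v2 * r1 - v1 * r2); lra.
Qed.

Lemma window_flux N :
  window (fun k => 4 * w k * (w (k + 1) + w (k - 1) - 2 * w k) -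
    v k ^+ 2 * (r (k + 1) ^+ 2 + r (k - 1) ^+ 2 - 2 * r k ^+ 2)) N.+1 <=
  4 * `|w (Posz N) * w (Posz N.+1)| + 4 * `|w (Negz N) * w (Negz N.+1)|.
Proof.
have tE k : 4 * w k * (w (k + 1) + w (k - 1) - 2 * w k) -
    v k ^+ 2 * (r (k + 1) ^+ 2 + r (k - 1) ^+ 2 - 2 * r k ^+ 2) = fluxR k + fluxL k.
  by rewrite /fluxR /fluxL; ring.
(* Every edge inside the window has a nonpositive total and is dropped; only the two edges that
   leave the window remain. *)
apply: (@le_trans _ _ (fluxR (Posz N) + fluxL (Negz N))).
  rewrite /window; elim: N => [|N IH].
    rewrite big_ord_recl big_ord0 addr0 !tE.
    by have := @edge (Negz 0) (Posz 0) erefl; lra.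
  rewrite big_ord_recr/= !tE; have e1 := @edge (Posz N) (Posz N.+1).
  have e2 := @edge (Negz N.+1) (Negz N).
  have {}e1 : fluxR (Posz N) + fluxL (Posz N.+1) <= 0 by apply: e1; lia.
  have {}e2 : fluxR (Negz N.+1) + fluxL (Negz N) <= 0 by apply: e2; lia.
  lra.
rewrite /fluxR /fluxL.
have -> : Posz N + 1 = Posz N.+1 by lia.
have -> : Negz N - 1 = Negz N.+1 by lia.
(* With [a = u * x] the left side is [4 * a * c - 3 * (u * x) ^+ 2 - (u * y) ^+ 2], so the boundary
   is controlled without any bound on the velocity [u]. *)
have b (a c u x y : R) : a = u * x ->
    4 * a * (c - a) - u ^+ 2 * (y ^+ 2 - x ^+ 2) <= 4 * `|a * c|.
  move=> ->; have := ler_norm (u * x * c); have := sqr_ge0 (u * x); have := sqr_ge0 (u * y).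
  rewrite !exprMn; lra.
by rewrite lerD// b.
Qed.

End FluxSum.

Section Contraction.
Variables (R : realType) (delta M T : R) (rho w m : int -> R) (y : R -> int -> R).
Implicit Types (t x : R) (k : int).
Local Notation rate := (rate delta M).
Hypotheses (d0 : 0 < delta) (M0 : 0 < M) (T0 : 0 < T) (rT : rate * T <= 1 / 16).
Hypotheses (y0 : forall k, y 0 k = rho k)
  (yM : forall t k, 0 <= t <= T -> 0 <= y t k <= M)
  (ypos : forall t k, 0 < t <= T -> 0 < y t k)
  (yc : forall k, {within `[0%R, T], continuous (fun t => y t k)})
  (yd : forall k t, 0 < t <= T ->
    is_derive t (1 : R) (fun t => y t k) (lapd delta (sqz (y t)) k)).
Hypotheses (wm : forall k, `|w k| <= m k)
  (mp : forall k, m (k + 1) <= 2 * m k) (mn : forall k, m (k - 1) <= 2 * m k)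
  (w0 : forall k, rho k = 0 -> w k = 0).

Local Notation U := (uflow delta rho w).

Let rM k : `|rho k| <= M.
Proof.
by have := @yM 0 k; rewrite lexx (ltW T0) y0 => /(_ isT)/andP[r0 r1]; rewrite ger0_norm.
Qed.

Let rate0 : 0 < rate.
Proof. by rewrite /rate divr_gt0 ?exprn_gt0// mulr_gt0. Qed.

Let rt t : 0 <= t <= T -> rate * `|t| <= 1 / 16.
Proof.
move=> /andP[t0 tT]; rewrite (ger0_norm t0); apply: le_trans rT.
by rewrite ler_wpM2l// ltW.
Qed.

Lemma flow_aflow t k : 0 <= t <= T -> y t k = aflow delta rho t k.
Proof.
apply: (@aflow_unique _ _ M d0 M0 rho rM y T) => //.
- by move=> x j xT; have /andP[r0 r1] := yM j xT; rewrite ger0_norm.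
- by move=> j x /andP[x0 xT]; apply: yd; rewrite x0 ltW.
Qed.

Let Ud t k : 0 <= t <= T ->
  is_derive t (1 : R) (fun t => U t k) (2 * (y t k * lapd delta (U t) k)).
Proof.
move=> tT; rewrite flow_aflow//; apply: (uflow_derive d0 M0 rM wm mp mn).
by have := rt tT; lra.
Qed.

Let Uc t k : 0 <= t <= T -> {for t, continuous (fun t => U t k)}.
Proof.
move=> tT; have [d _] := @Ud t k tT.
exact/differentiable_continuous/derivable1_diffP.
Qed.

Let Ule t k : 0 <= t <= T -> `|U t k| <= 2 * m k.
Proof. by move=> tT; apply: (uflow_le d0 M0 rM wm mp mn); have := rt tT; lra. Qed.

Let m0 k : 0 <= m k. Proof. exact: le_trans (wm k). Qed.

Definition qratio t k : R := U t k ^+ 2 / y t k.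

Lemma ratio_derive t k : 0 < t <= T -> is_derive t (1 : R) (fun t => qratio t k)
  (4 * U t k * lapd delta (U t) k - (U t k / y t k) ^+ 2 * lapd delta (sqz (y t)) k).
Proof.
move=> tT; have yp := ypos k tT; have tT' : 0 <= t <= T by case/andP: tT => /ltW-> ->.
have D1 := @Ud t k tT'; have D2 := yd k tT.
have yn : y t k != 0 by rewrite gt_eqF.
rewrite /qratio.
have D3 := is_deriveX 2 D1.
have D4 := @is_deriveV _ (fun t => y t k) t _ 1 yn D2.
apply: (is_derive_eq (is_deriveM D3 D4)).
rewrite -[LHS]/(U t k ^+ 2 * (- y t k ^- 2 * lapd delta (sqz (y t)) k) +
  (y t k)^-1 * ((2 * U t k) * (2 * (y t k * lapd delta (U t) k)))).
by field.
Qed.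

(** The mean value theorem is applied on [[x, T]] with [x > 0], where the quotient is differentiable
    because the densities are positive. The 16 is the 4 of [window_flux] times the 4 that comes from
    [|U| <= 2 * m] used twice. *)
Lemma window_ratio_le N x : 0 < x < T -> window (qratio T) N.+1 <=
  window (qratio x) N.+1 +
  T * (16 / delta ^+ 2 * (m (Posz N) * m (Posz N.+1) + m (Negz N) * m (Negz N.+1))).
Proof.
move=> /andP[x0 xT].
set B := 16 / _ * _.
pose term t k := 4 * U t k * lapd delta (U t) k -
  (U t k / y t k) ^+ 2 * lapd delta (sqz (y t)) k.
have dW n t : 0 < t <= T -> is_derive t (1 : R) (fun t => window (qratio t) n) (window (term t) n).
  move=> tT; rewrite /window; elim: n => [|n IH].
    under eq_fun do rewrite big_ord0; rewrite big_ord0; exact: is_derive_cst.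
  under eq_fun do rewrite big_ord_recr/=; rewrite big_ord_recr/=.
  apply: is_deriveD; apply: is_deriveD; exact: ratio_derive.
have tB t : 0 < t <= T -> window (term t) N.+1 <= B.
  move=> tT; have tT' : 0 <= t <= T by case/andP: tT => /ltW-> ->.
  have e : forall k, U t k = U t k / y t k * y t k.
    by move=> k; rewrite divfK// gt_eqF// ypos.
  have := window_flux e N.
  set W := window _ _ => WB.
  have -> : window (term t) N.+1 = W / delta ^+ 2.
    rewrite /W /window mulr_suml; apply: eq_bigr => n _.
    by rewrite /term /lapd /sqz; ring.
  rewrite ler_pdivrMr ?exprn_gt0//; apply: (le_trans WB).
  rewrite /B mulrAC mulfVK ?gt_eqF ?exprn_gt0//.
  have h i j : `|U t i * U t j| <= 4 * (m i * m j).
    rewrite normrM; have := ler_pM (normr_ge0 _) (normr_ge0 _) (Ule i tT') (Ule j tT'); lra.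
  by have := h (Posz N) (Posz N.+1); have := h (Negz N) (Negz N.+1); lra.
have xT' t : x <= t <= T -> 0 < t <= T by move=> /andP[/(lt_le_trans x0)-> ->].
have Wc : {within `[x, T], continuous (fun t => window (qratio t) N.+1)}.
  apply: derivable_within_continuous => t; rewrite in_itv/= => /xT' tT.
  by have [] := dW N.+1 t tT.
have Wd t : t \in `]x, T[ ->
    is_derive t (1 : R) (fun t => window (qratio t) N.+1) (window (term t) N.+1).
  by rewrite in_itv/= => /andP[/ltW xt /ltW tT]; apply: dW; apply: xT'; rewrite xt.
have [c cxT E] := MVT xT Wd Wc.
have cB : window (term c) N.+1 <= B.
  by apply: tB; apply: xT'; move: cxT; rewrite in_itv/= => /andP[/ltW-> /ltW->].
have B0 : 0 <= B by rewrite /B !mulr_ge0 ?addr_ge0 ?mulr_ge0 ?invr_ge0 ?exprn_ge0 ?(ltW d0).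
rewrite -lerBlDl E.
apply: (@le_trans _ _ (B * (T - x))); first by rewrite ler_wpM2r// subr_ge0 ltW.
by rewrite mulrC ler_wpM2r// gerBl ltW.
Qed.

(* [(1 + 2 c t) y] is nondecreasing for small [t] because [y' >= - c y]. *)
Lemma flow_doubling x t k : 0 < x <= t -> t <= T -> y x k <= 2 * y t k.
Proof.
move=> /andP[x0]; rewrite le_eqVlt => /predU1P[xt tT|xt tT].
  by rewrite xt in x0 *; have := @ypos t k; rewrite x0 tT => /(_ isT); lra.
pose c := 2 * M / delta ^+ 2.
have dd : 0 < (delta ^+ 2)^-1 by rewrite invr_gt0 exprn_gt0.
have c0 : 0 < c by rewrite /c divr_gt0 ?exprn_gt0// mulr_gt0.
have cT : c * T <= 1 / 96 by move: rT; rewrite /rate /c; lra.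
have inT s : x <= s <= t -> 0 < s <= T.
  by move=> /andP[/(lt_le_trans x0)-> /le_trans]; apply.
pose f s := y s k * (1 + 2 * c * s).
pose df s := y s k * (2 * c) + (1 + 2 * c * s) * lapd delta (sqz (y s)) k.
have fd s : 0 < s <= T -> is_derive s (1 : R) f (df s).
  move=> sT; have D1 := yd k sT.
  have D2 : is_derive s (1 : R) (fun s => 1 + 2 * c * s) (2 * c).
    apply: (is_derive_eq (is_deriveD (is_derive_cst (1 : R) (s : R) (1 : R))
      (is_deriveZ (2 * c) (is_derive_id (s : R) (1 : R))))).
    by rewrite add0r /GRing.scale/= mulr1.
  by apply: (is_derive_eq (is_deriveM D1 D2)).
have fc : {within `[x, t], continuous f}.
  apply: derivable_within_continuous => s; rewrite in_itv/= => /inT sT.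
  by have [] := fd s sT.
have fd' s : s \in `]x, t[ -> is_derive s (1 : R) f (df s).
  by rewrite in_itv/= => /andP[/ltW xs /ltW st]; apply: fd; apply: inT; rewrite xs.
have [s sxt E] := MVT xt fd' fc.
have sT : 0 < s <= T.
  by apply: inT; move: sxt; rewrite in_itv/= => /andP[/ltW-> /ltW->].
have cs u : 0 < u <= T -> 0 <= c * u <= 1 / 96.
  move=> /andP[/ltW u0 uT]; rewrite mulr_ge0 ?(ltW c0)//=; apply: le_trans cT.
  by rewrite ler_wpM2l// ltW.
have df0 : 0 <= df s.
  have sT' : 0 <= s <= T by case/andP: sT => /ltW-> ->.
  have /andP[ys0 ysM] := yM k sT'.
  have l : - (c * y s k) <= lapd delta (sqz (y s)) k.
    rewrite /lapd /sqz /c.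
    have h1 := sqr_ge0 (y s (k + 1)); have h2 := sqr_ge0 (y s (k - 1)).
    have h3 : y s k ^+ 2 <= M * y s k by rewrite expr2 ler_wpM2r.
    have -> : - (2 * M / delta ^+ 2 * y s k) = (- 2 * (M * y s k)) / delta ^+ 2 by ring.
    by rewrite ler_wpM2r ?(ltW dd)//; lra.
  have /andP[cs0 cs1] := cs _ sT.
  have := ler_wpM2l (_ : 0 <= 1 + 2 * c * s) l.
  rewrite /df => /(_ _); have e : 0 <= 1 + 2 * c * s by lra.
  move=> /(_ e) l'; apply: le_trans (_ : y s k * (2 * c) + (1 + 2 * c * s) * - (c * y s k) <= _).
    have -> : y s k * (2 * c) + (1 + 2 * c * s) * - (c * y s k) = c * y s k * (1 - 2 * (c * s)) by ring.
    by apply: mulr_ge0; [rewrite mulr_ge0// ltW|lra].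
  by rewrite lerD2l.
have : f x <= f t by rewrite -subr_ge0 E mulr_ge0// subr_ge0 ltW.
have xT : 0 < x <= T by apply: inT; rewrite lexx ltW.
have tT' : 0 < t <= T by apply: inT; rewrite lexx ltW.
have := ypos k xT; have := ypos k tT'; have := cs _ xT; have := cs _ tT'.
rewrite /f -!(mulrA 2 c); set a := c * x; set b := c * t; nra.
Qed.

(** Away from vacuum this is continuity. At a vacuum site the limit must be 0 although numerator and
    denominator both vanish: [U' = 2 y lapd U] starts from 0, and [flow_doubling] compares earlier
    values of [y] with [y t], so [U] is of order [t * y t] and [U^2 / y] of order [t^2]. *)
Lemma ratio_cvg0 k : qratio t k @[t --> 0^'+] --> w k ^+ 2 / rho k.
Proof.
have T00 : (0 : R) <= 0 <= T by rewrite lexx ltW.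
have Uc0 : U t k @[t --> 0^'+] --> w k.
  have -> : w k = U 0 k by rewrite uflow0.
  by apply: cvg_at_right_filter; exact: Uc.
have [rk|rk] := eqVneq (rho k) 0; last first.
  have yc0 : y t k @[t --> 0^'+] --> rho k.
    by have /(continuous_within_itvP _ T0)[_ + _] := @yc k; rewrite y0.
  rewrite /qratio expr2; under eq_fun do rewrite expr2.
  by apply: cvgM; [apply: cvgM|apply: cvgV].
rewrite w0// expr0n/= mul0r.
(* Bound for [lapd delta (U s) k]: [|U| <= 2 * m] and the doubling of [m] give [4 * m k] for each
   neighbour and [4 * m k] for twice the centre. *)
pose L := 12 * m k / delta ^+ 2.
have L0 : 0 <= L by rewrite /L divr_ge0 ?exprn_ge0 ?(ltW d0)// mulr_ge0.
have UL t : 0 < t <= T -> `|U t k| <= 4 * y t k * L * t.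
  move=> /andP[t0 tT].
  have fc : {within `[0%R, t], continuous (fun t => U t k)}.
    apply: derivable_within_continuous => s; rewrite in_itv/= => /andP[s0 st].
    by have [] := @Ud s k _; rewrite ?s0 ?(le_trans st tT).
  have fd s : 0 < s < t -> is_derive s (1 : R) (fun t => U t k) (2 * (y s k * lapd delta (U s) k)).
    by move=> /andP[/ltW s0 /ltW st]; apply: Ud; rewrite s0 (le_trans st tT).
  have := mvt_bound (ltW t0) fd fc.
  rewrite uflow0 w0// !subr0; apply.
  move=> s /andP[s0 st].
  have sT : 0 <= s <= T by rewrite (ltW s0) (le_trans (ltW st) tT).
  have sT' : 0 < s <= T by rewrite s0 (le_trans (ltW st) tT).
  have l : `|lapd delta (U s) k| <= L.
    apply: (le_trans (lapd_norm d0 _ _)).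
    rewrite /L ler_wpM2r ?invr_ge0 ?exprn_ge0 ?(ltW d0)//.
    by have := Ule k sT; have := Ule (k + 1) sT; have := Ule (k - 1) sT; have := mp k; have := mn k; lra.
  have ys := ypos k sT'.
  rewrite normrM (@ger0_norm _ 2)// normrM (gtr0_norm ys).
  have yy : y s k <= 2 * y t k by apply: flow_doubling => //; rewrite s0 ltW.
  have := ler_pM (ltW ys) (normr_ge0 _) yy l; lra.
have b0 : 16 * L ^+ 2 * M * (t * t) @[t --> 0^'+] --> (0 : R).
  have id0 : (t : R) @[t --> (0 : R)^'+] --> (0 : R) by apply: cvg_at_right_filter; exact: cvg_id.
  rewrite -[X in _ --> X](_ : 16 * L ^+ 2 * M * (0 * 0) = 0); last by rewrite !mulr0.
  by apply: cvgM; [exact: cvg_cst|apply: cvgM].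
apply: (squeeze_cvgr _ (cvg_cst (0 : R)) b0).
near=> t.
have t0 : 0 < t by near: t; exact: nbhs_right_gt.
have tT : t <= T by near: t; exact: nbhs_right_le.
have tT' : 0 < t <= T by rewrite t0.
have yp := ypos k tT'; have /andP[_ yMt] : 0 <= y t k <= M by apply: yM; rewrite (ltW t0).
rewrite /qratio divr_ge0 ?sqr_ge0 ?(ltW yp)//= ler_pdivrMr//.
rewrite -[X in X <= _]ger0_norm ?sqr_ge0// normrX.
have h := UL t tT'.
apply: (@le_trans _ _ ((4 * y t k * L * t) ^+ 2)).
  by rewrite !expr2; apply: ler_pM.
have -> : (4 * y t k * L * t) ^+ 2 = (16 * L ^+ 2 * (t * t)) * (y t k * y t k) by ring.
have -> : 16 * L ^+ 2 * M * (t * t) * y t k = (16 * L ^+ 2 * (t * t)) * (M * y t k) by ring.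
have P : 0 <= 16 * L ^+ 2 * (t * t).
  by apply: mulr_ge0; [apply: mulr_ge0 => //; exact: sqr_ge0|apply: mulr_ge0; exact: ltW].
by apply: ler_wpM2l => //; apply: ler_wpM2r => //; exact: ltW.
Unshelve. all: by end_near. Qed.

Lemma window_contraction N : window (qratio T) N.+1 <=
  window (fun k => w k ^+ 2 / rho k) N.+1 +
  T * (16 / delta ^+ 2 * (m (Posz N) * m (Posz N.+1) + m (Negz N) * m (Negz N.+1))).
Proof.
set B := T * _.
have wc n : window (qratio t) n @[t --> 0^'+] --> window (fun k => w k ^+ 2 / rho k) n.
  rewrite /window; elim: n => [|n IH].
    by under eq_fun do rewrite big_ord0; rewrite big_ord0; exact: cvg_cst.
  under eq_fun do rewrite big_ord_recr/=; rewrite big_ord_recr/=.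
  by apply: (@cvgD _ (R : normedModType R)) => //;
    apply: (@cvgD _ (R : normedModType R)); exact: ratio_cvg0.
have c : window (qratio t) N.+1 + B @[t --> 0^'+] --> window (fun k => w k ^+ 2 / rho k) N.+1 + B.
  by apply: (@cvgD _ (R : normedModType R)); [exact: wc|exact: cvg_cst].
rewrite -(cvg_lim (@Rhausdorff R) c); apply: limr_ge; first by apply/cvg_ex; eexists; exact: c.
near=> t; apply: window_ratio_le; apply/andP; split; near: t.
  exact: nbhs_right_gt.
exact: nbhs_right_lt.
Unshelve. all: by end_near. Qed.

(** The fixed window is enlarged to [n.+1], where [window_contraction] holds up to a boundary term;
    this term disappears as [n] grows because [m] is square summable. *)
Lemma flow_contraction N : (\esum_(k in [set: int]) ((m k) ^+ 2)%:E < +oo)%E ->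
  ((window (qratio T) N)%:E <= \esum_(k in [set: int]) (w k ^+ 2 / rho k)%:E)%E.
Proof.
move=> mfin.
have T00 : (0 : R) <= 0 <= T by rewrite lexx ltW.
have rho0 k : 0 <= rho k by have /andP[] := yM k T00; rewrite y0.
have q0 k : 0 <= w k ^+ 2 / rho k by rewrite divr_ge0 ?sqr_ge0.
have r0 k : 0 <= qratio T k.
  by rewrite /qratio divr_ge0 ?sqr_ge0// ltW// ypos// T0 lexx.
have [fin|] := boolP ((\esum_(k in [set: int]) (w k ^+ 2 / rho k)%:E) \is a fin_num)%E; last first.
  rewrite ge0_fin_numE; last by apply: esum_ge0 => k _; rewrite lee_fin.
  by rewrite -leNgt leye_eq => /eqP->; rewrite leey.
rewrite -(fineK fin) lee_fin; set e := fine _.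
have [c1 c2] := summable_terms_cvg0 (fun k => sqr_ge0 (m k)) mfin.
(* The doubling property bounds the product of neighbouring weights by [2 * m ^+ 2] at the inner
   site, whose convergence to 0 is already known. *)
pose B n := T * (16 / delta ^+ 2 * (2 * m (Posz n) ^+ 2 + 2 * m (Negz n) ^+ 2)).
have cB : e + B n @[n --> \oo] --> e.
  rewrite -[X in _ --> X]addr0; apply: (@cvgD _ (R : normedModType R)); first exact: cvg_cst.
  rewrite -[X in _ --> X](_ : T * (16 / delta ^+ 2 * (2 * 0 + 2 * 0)) = 0); last by ring.
  apply: cvgM; first exact: cvg_cst.
  apply: cvgM; first exact: cvg_cst.
  by apply: (@cvgD _ (R : normedModType R)); apply: cvgM => //; exact: cvg_cst.
rewrite -(cvg_lim (@Rhausdorff R) cB); apply: limr_ge; first by apply/cvg_ex; eexists; exact: cB.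
near=> n.
have Nn : (N <= n.+1)%N by apply: leqW; near: n; exact: nbhs_infty_ge.
apply: (@le_trans _ _ (window (qratio T) n.+1)).
  rewrite /window -!(big_mkord xpredT (fun n => qratio T (Posz n) + qratio T (Negz n))).
  rewrite [leRHS](@big_cat_nat _ _ _ N)//= lerDl sumr_ge0// => i _.
  by rewrite addr_ge0.
apply: (le_trans (window_contraction n)); apply: lerD.
  by rewrite -lee_fin fineK//; exact: window_le_esum.
rewrite /B ler_wpM2l ?(ltW T0)// ler_wpM2l ?divr_ge0 ?exprn_ge0 ?(ltW d0)//.
have -> : Posz n.+1 = Posz n + 1 by rewrite -PoszD addn1.
have -> : Negz n.+1 = Negz n - 1 by lia.
by have := mp (Posz n); have := mn (Negz n); have := m0 (Posz n); have := m0 (Negz n); nra.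
Unshelve. all: by end_near. Qed.

End Contraction.

(** * The energy through cumulative sums *)

Section Cumulative.
Variable R : realType.
Implicit Types (r : int -> R) (k : int).

(** The distribution function, written as a limit of finite sums so that [prim_lim] can
    differentiate it along a curve. *)
Definition cumul r k : R := limn (series (fun i => r (k - Posz i))).

Lemma esum_shift k (f : int -> \bar R) :
  (\esum_(j in [set: int]) f (k + j)%R = \esum_(j in [set: int]) f j)%E.
Proof.
rewrite [RHS](@reindex_esum _ _ _ [set: int] _ (fun j => k + j))//.
Qed.

Lemma esum_delta (p : int) (x : R) : 0 <= x ->
  (\esum_(k in [set: int]) (if k == p then x else 0)%:E = x%:E)%E.
Proof.
move=> x0; rewrite -(@esum_set1 _ _ p (fun=> x%:E))// [RHS]esum_mkcond.
apply: eq_esum => k _; have -> : (k \in [set p]%classic) = (k == p) by apply/idP/eqP; rewrite inE.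
by case: eqP.
Qed.

Lemma esum_count (p q : int) :
  (\esum_(k in [set: int]) (if (p <= k) && (k < q) then 1 else 0 : R)%:E =
   (if p <= q then (q - p)%:~R else 0 : R)%:E)%E.
Proof.
have [pq|qp] := leP p q; last first.
  by rewrite esum1// => k _; case: ifP => //; lia.
have -> : q = p + Posz `|q - p|%N by lia.
move: `|q - p|%N => n {pq}; elim: n => [|n IH].
  rewrite esum1 => [|k _]; first by rewrite addr0 subrr.
  by case: ifP => //; lia.
transitivity (\esum_(k in [set: int]) ((if (p <= k) && (k < p + Posz n) then 1 else 0 : R)%:E +
    (if k == p + Posz n then 1 else 0 : R)%:E))%E.
  apply: eq_esum => k _; rewrite -EFinD; congr EFin.
  case: (eqVneq k (p + Posz n)) => [->|kn].
    have -> : (p + Posz n < p + Posz n) = false by lia.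
    have -> : (p <= p + Posz n) && (p + Posz n < p + Posz n.+1) by lia.
    by rewrite andbF add0r.
  rewrite addr0; congr (if _ then _ else _); lia.
rewrite esumD => [|k _|k _]; [|by case: ifP|by case: ifP].
rewrite IH esum_delta// -EFinD; congr EFin.
have -> : p + Posz n.+1 - p = (p + Posz n - p) + 1 by lia.
by move: (p + Posz n - p) => a; rewrite intrD.
Qed.

Section Summable.
Variables (r : int -> R) (S : R).
Hypotheses (r0 : forall k, 0 <= r k)
  (rS : (\esum_(k in [set: int]) (r k)%:E = S%:E)%E).

Lemma cumul_esum k :
  (\esum_(j in [set: int]) (if j <= k then r j else 0)%:E = (cumul r k)%:E)%E /\
  series (fun i => r (k - Posz i)) n @[n --> \oo] --> cumul r k.
Proof.
have nn j : (0 <= (if j <= k then r j else 0)%:E)%E by rewrite lee_fin; case: ifP.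
have E1 : (\esum_(j in [set: int]) (if j <= k then r j else 0)%:E =
    \sum_(0 <= i <oo) (r (k - Posz i))%:E)%E.
  rewrite nneseries_esumT; last by move=> i; rewrite lee_fin.
  rewrite -(@reindex_esum _ _ _ [set: nat] [set j | j <= k] (fun i => k - Posz i) (fun j => (r j)%:E)).
    rewrite [RHS]esum_mkcond; apply: eq_esum => j _.
    have -> : (j \in [set j | j <= k]%classic) = (j <= k) by apply/idP/idP; rewrite inE.
    by case: ifP.
  split.
  - by move=> i _ /=; lia.
  - by move=> x y _ _ /=; lia.
  - by move=> j /= jk; exists `|k - j|%N => //=; lia.
have fin : (\sum_(0 <= i <oo) (r (k - Posz i))%:E)%E \is a fin_num.
  rewrite -E1 ge0_fin_numE; last by apply: esum_ge0.
  apply: (@le_lt_trans _ _ S%:E); last exact: ltry.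
  by rewrite -rS; apply: le_esum => j _; rewrite lee_fin; case: ifP.
have c : series (fun i => r (k - Posz i)) n @[n --> \oo] -->
    fine (\sum_(0 <= i <oo) (r (k - Posz i))%:E)%E.
  have c0 : (\sum_(0 <= i < n) (r (k - Posz i))%:E)%E @[n --> \oo] -->
      (fine (\sum_(0 <= i <oo) (r (k - Posz i))%:E)%E)%:E.
    by rewrite fineK//; apply: is_cvg_ereal_nneg_natsum => n _; rewrite lee_fin.
  apply: (cvg_trans _ (fine_cvg c0)); apply: near_eq_cvg.
  by near=> n; rewrite /= sumEFin.
have -> : cumul r k = fine (\sum_(0 <= i <oo) (r (k - Posz i))%:E)%E.
  by rewrite /cumul (cvg_lim _ c).
by split=> //; rewrite E1 fineK.
Unshelve. all: by end_near. Qed.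

Lemma cumul_cvg k : series (fun i => r (k - Posz i)) n @[n --> \oo] --> cumul r k.
Proof. by have [] := cumul_esum k. Qed.

Lemma esum_le_cumul k :
  (\esum_(j in [set: int]) (if j <= k then r j else 0)%:E = (cumul r k)%:E)%E.
Proof. by have [] := cumul_esum k. Qed.

Lemma esum_gt_cumul k :
  (\esum_(j in [set: int]) (if k < j then r j else 0)%:E = (S - cumul r k)%:E)%E.
Proof.
have : (\esum_(j in [set: int]) (if j <= k then r j else 0)%:E +
    \esum_(j in [set: int]) (if (k < j)%R then r j else 0)%:E = S%:E)%E.
  rewrite -esumD => [|j _|j _]; [|by rewrite lee_fin; case: ifP|by rewrite lee_fin; case: ifP].
  rewrite -rS; apply: eq_esum => j _; rewrite -EFinD; congr EFin.
  by case: leP => _; rewrite ?addr0 ?add0r.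
rewrite esum_le_cumul EFinB => <-.
by rewrite addeAC subee// add0e.
Qed.

Lemma cumul_ge0 k : 0 <= cumul r k.
Proof.
rewrite -lee_fin -esum_le_cumul; apply: esum_ge0 => j _.
by rewrite lee_fin; case: ifP.
Qed.

Lemma cumul_le k : cumul r k <= S.
Proof.
rewrite -subr_ge0 -lee_fin -esum_gt_cumul; apply: esum_ge0 => j _.
by rewrite lee_fin; case: ifP.
Qed.

Lemma cumul_rec k : cumul r k = cumul r (k - 1) + r k.
Proof.
apply/EFin_inj; rewrite EFinD -!esum_le_cumul -(esum_delta k (r0 k)).
rewrite -esumD => [|j _|j _]; [|by rewrite lee_fin; case: ifP|by rewrite lee_fin; case: ifP].
apply: eq_esum => j _; rewrite -EFinD; congr EFin.
have [->|jk] := eqVneq j k.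
  by rewrite lexx (_ : (k <= k - 1) = false) ?add0r//; lia.
by rewrite addr0; congr (if _ then _ else _); lia.
Qed.

(** The distance [|p - q|] counts the integers [k] that separate [p] from [q], and
    [cumul r k * (S - cumul r k)] sums [r p * r q] over the pairs with [p <= k < q]. The factor 2
    accounts for the two orders of the pair. *)
Lemma esum_pair_dist :
  (\esum_(p in [set: int * int]) ((`|p.1 - p.2|%:~R : R) * r p.1 * r p.2)%:E =
   2%:E * \esum_(k in [set: int]) (cumul r k * (S - cumul r k))%:E)%E.
Proof.
pose pos (p q : int) : R := if p <= q then (q - p)%:~R else 0.
have pos0 p q : 0 <= pos p q by rewrite /pos; case: ifP => // pq; rewrite ler0z subr_ge0.
have tp0 p q : (0 <= (pos p q * r p * r q)%:E)%E by rewrite lee_fin !mulr_ge0.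
have E1 : (\esum_(k in [set: int]) (cumul r k * (S - cumul r k))%:E =
    \esum_(p in [set: int]) \esum_(q in [set: int]) (pos p q * r p * r q)%:E)%E.
  pose a (k p q : int) : R := (if p <= k then r p else 0) * (if k < q then r q else 0).
  have a0 k p q : (0 <= (a k p q)%:E)%E.
    by rewrite lee_fin mulr_ge0//; case: ifP.
  have Ek k : ((cumul r k * (S - cumul r k))%:E =
      \esum_(p in [set: int]) \esum_(q in [set: int]) (a k p q)%:E)%E.
    rewrite EFinM -esum_gt_cumul muleC esum_gt_cumul -esum_le_cumul -esum_intZl.
    - apply: eq_esum => p _; rewrite muleC -esum_gt_cumul -esum_intZl//.
      + by case: ifP.
      + by move=> q; rewrite lee_fin; case: ifP.
    - by rewrite subr_ge0 cumul_le.
    - by move=> p; rewrite lee_fin; case: ifP.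
  rewrite (eq_esum (fun k _ => Ek k)) esum_swap; last by move=> k p; apply: esum_ge0.
  apply: eq_esum => p _; rewrite esum_swap//; apply: eq_esum => q _.
  rewrite /pos -mulrA mulrC EFinM -esum_count -esum_intZl ?mulr_ge0//; last first.
    by move=> k; rewrite lee_fin; case: ifP.
  apply: eq_esum => k _; rewrite -EFinM /a; congr EFin.
  by case: (leP p k) => _; case: (ltP k q) => _ /=; rewrite ?mulr0 ?mul0r ?mulr1.
rewrite E1.
have -> : (\esum_(p in [set: int * int]) ((`|p.1 - p.2|%:~R : R) * r p.1 * r p.2)%:E =
   \esum_(p in [set: int]) \esum_(q in [set: int]) ((`|p - q|%:~R : R) * r p * r q)%:E)%E.
  rewrite (@esum_esum _ _ _ setT (fun=> setT) (fun p q => ((`|p - q|%:~R : R) * r p * r q)%:E)).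
    congr esum; apply/seteqP; split=> //.
  by move=> p q _ _; rewrite lee_fin !mulr_ge0// ler0z.
rewrite mule_natl mule2n [X in (_ + X)%E]esum_swap//.
rewrite -esumD => [|p _|p _]; [|by apply: esum_ge0|by apply: esum_ge0].
apply: eq_esum => p _; rewrite -esumD//; apply: eq_esum => q _.
rewrite -EFinD; congr EFin; rewrite [pos q p * _ * _]mulrAC -!mulrDl; congr (_ * _ * _).
rewrite /pos; case: (ltrgtP p q) => pq.
- by rewrite addr0.
- by rewrite add0r.
- by rewrite pq subrr addr0.
Qed.

End Summable.

End Cumulative.

Section States.
Variables (R : realType) (delta : R).
Hypothesis d0 : 0 < delta.
Implicit Types (r : int -> R) (k : int).

Lemma Pd2c_ge0 r k : Pd2c delta r -> 0 <= r k.
Proof. by case. Qed.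

Lemma Pd2c_sum r : Pd2c delta r ->
  (\esum_(k in [set: int]) (r k)%:E = (delta^-1)%:E)%E.
Proof.
move=> [r0 + _ _].
have : (0 <= \esum_(k in [set: int]) (r k)%:E)%E by apply: esum_ge0 => k _; rewrite lee_fin.
case: (\esum_(k in [set: int]) (r k)%:E)%E => [x|_|//].
  move=> _; rewrite -EFinM => -[e]; congr EFin.
  by rewrite -[LHS](mulKf (lt0r_neq0 d0)) e mulr1.
by rewrite gt0_muley ?lte_fin.
Qed.

Lemma Pd2c_le r k : Pd2c delta r -> r k <= delta^-1.
Proof.
move=> rP; rewrite -lee_fin -(Pd2c_sum rP); apply: term_le_esum => j.
exact: Pd2c_ge0.
Qed.

(** An integer is at most its square, so [|p - q| <= p^2 + q^2], and the double sum is at most twice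
    the second moment times the mass. This is what makes the energy a real number. *)
Lemma Pd2c_pair_fin r : Pd2c delta r ->
  (\esum_(p in [set: int * int]) ((`|p.1 - p.2|%:~R : R) * r p.1 * r p.2)%:E < +oo)%E.
Proof.
move=> rP; have r0 k := Pd2c_ge0 k rP; have rS := Pd2c_sum rP.
have [_ _ r2 _] := rP.
pose K := (\esum_(k in [set: int]) ((k%:~R ^+ 2 : R) * r k)%:E)%E.
have K0 : (0 <= K)%E by apply: esum_ge0 => k _; rewrite lee_fin mulr_ge0 ?sqr_ge0.
have Kfin : K \is a fin_num.
  rewrite ge0_fin_numE//.
  have -> : K = ((delta ^- 2)%:E * \esum_(k in [set: int]) (((delta * k%:~R) ^+ 2) * r k)%:E)%E.
    rewrite -esum_intZl ?invr_ge0 ?sqr_ge0//; last first.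
      by move=> k; rewrite lee_fin mulr_ge0 ?sqr_ge0.
    apply: eq_esum => k _; rewrite -EFinM; congr EFin.
    by field; rewrite gt_eqF.
  by rewrite lte_mul_pinfty// lee_fin invr_ge0 sqr_ge0.
have half : (\esum_(p in [set: int]) \esum_(q in [set: int])
    ((p%:~R ^+ 2 : R) * r p * r q)%:E = K * (delta^-1)%:E)%E.
  rewrite muleC /K -esum_intZl ?invr_ge0 ?(ltW d0)//; last first.
    by move=> k; rewrite lee_fin mulr_ge0 ?sqr_ge0.
  apply: eq_esum => p _; rewrite muleC -rS -esum_intZl; [|by rewrite mulr_ge0 ?sqr_ge0|by move=> q; rewrite lee_fin].
  by apply: eq_esum => q _; rewrite -EFinM.
have nn (p q : int) : (0 <= ((p%:~R ^+ 2 : R) * r p * r q)%:E)%E.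
  by rewrite lee_fin; apply: mulr_ge0 => //; apply: mulr_ge0 => //; exact: sqr_ge0.
apply: (@le_lt_trans _ _ (\esum_(p in [set: int]) \esum_(q in [set: int])
    (((p%:~R ^+ 2 : R) * r p * r q)%:E + ((q%:~R ^+ 2 : R) * r q * r p)%:E))%E).
  rewrite (@esum_esum _ _ _ setT (fun=> setT) (fun p q => ((p%:~R ^+ 2 : R) * r p * r q)%:E + ((q%:~R ^+ 2 : R) * r q * r p)%:E)%E); last first.
    by move=> p q _ _; rewrite adde_ge0.
  rewrite (_ : [set: int] `*`` (fun=> setT) = [set: int * int]); last exact/seteqP.
  apply: le_esum => -[p q] _ /=; rewrite -EFinD lee_fin.
  have -> : p%:~R ^+ 2 * r p * r q + q%:~R ^+ 2 * r q * r p =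
    (p%:~R ^+ 2 + q%:~R ^+ 2) * r p * r q by ring.
  rewrite !ler_wpM2r// -!rmorphXn/= -rmorphD/= ler_int.
  have sq (z : int) : `|z| <= z ^+ 2.
    by rewrite expr2; case: (leP 0 z) => z0; [rewrite ger0_norm//|rewrite ltr0_norm//]; nia.
  by apply: (le_trans (ler_normB _ _)); exact: lerD.
under eq_esum do rewrite esumD//.
rewrite esumD; [|by move=> p _; apply: esum_ge0|by move=> p _; apply: esum_ge0].
rewrite [X in (_ + X < _)%E]esum_swap// half.
by rewrite -(fineK Kfin) -EFinM -EFinD ltry.
Qed.

(** In this form the energy has a local derivative along a curve, since [cumul] at [k] only feels
    [w] at [k] and [k + 1]. The factor 2 of [esum_pair_dist] turns [delta ^+ 3 / 4] into
    [delta ^+ 3 / 2]. *)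
Definition energyR r : R := - (delta ^+ 3 / 2) *
  fine (\esum_(k in [set: int]) (cumul r k * (delta^-1 - cumul r k))%:E)%E.

Lemma cumul_pair_ge0 r k : Pd2c delta r -> 0 <= cumul r k * (delta^-1 - cumul r k).
Proof.
move=> rP; have r0 j := Pd2c_ge0 j rP; have rS := Pd2c_sum rP.
by rewrite mulr_ge0 ?(cumul_ge0 r0 rS)// subr_ge0 (cumul_le r0 rS).
Qed.

Lemma cumul_pair_fin r : Pd2c delta r ->
  (\esum_(k in [set: int]) (cumul r k * (delta^-1 - cumul r k))%:E)%E \is a fin_num.
Proof.
move=> rP; have r0 j := Pd2c_ge0 j rP; have rS := Pd2c_sum rP.
have X0 : (0 <= \esum_(k in [set: int]) (cumul r k * (delta^-1 - cumul r k))%:E)%E.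
  by apply: esum_ge0 => k _; rewrite lee_fin cumul_pair_ge0.
rewrite ge0_fin_numE//; apply: le_lt_trans (Pd2c_pair_fin rP).
rewrite (esum_pair_dist r0 rS) -[leLHS]mul1e.
by apply: lee_wpmul2r => //; rewrite lee_fin; lra.
Qed.

Lemma energyE r : Pd2c delta r -> energy delta r = (energyR r)%:E.
Proof.
move=> rP; have r0 j := Pd2c_ge0 j rP; have rS := Pd2c_sum rP.
rewrite /energy (esum_pair_dist r0 rS) -(fineK (cumul_pair_fin rP)) -!EFinM -EFinN.
by rewrite /energyR; congr EFin; field.
Qed.

Lemma energyR_cvg r : Pd2c delta r ->
  - (delta ^+ 3 / 2) * window (fun k => cumul r k * (delta^-1 - cumul r k)) n
  @[n --> \oo] --> energyR r.
Proof.
move=> rP; apply: cvgM; first exact: cvg_cst.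
have := @cvg_window _ (fun k => cumul r k * (delta^-1 - cumul r k)) (fun k => cumul_pair_ge0 k rP).
by rewrite -{1}(fineK (cumul_pair_fin rP)) => /fine_cvg.
Qed.

End States.

(** * The action density *)

Section Qfun.
Variables (R : realType).

Lemma Qf_ge0 (p r : R) : (0 <= Qf p r)%E.
Proof.
rewrite /Qf; case: ifP => [r0|_]; first by rewrite lee_fin divr_ge0 ?sqr_ge0// ltW.
by case: ifP => _; rewrite ?leey.
Qed.

(** Densities are at most [delta^-1], so finite action makes the sum of the squares of [w]
    integrable in [s]. *)
Lemma sqr_le_Qf (M p r : R) : 0 < M -> r <= M -> ((p ^+ 2)%:E <= M%:E * Qf p r)%E.
Proof.
move=> M0 rM; rewrite /Qf; case: ifP => [r0|_].
  rewrite -EFinM lee_fin mulrA ler_pdivlMr// mulrC ler_wpM2r ?sqr_ge0//.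
case: eqP => [->|_]; first by rewrite expr0n/= mule0.
by rewrite gt0_muley ?lte_fin// leey.
Qed.

Lemma measurable_Qf (d : measure_display) (T : measurableType d) (D : set T) (p r : T -> R) :
  measurable D -> measurable_fun D p -> measurable_fun D r ->
  measurable_fun D (fun s => Qf (p s) (r s)).
Proof.
move=> mD mp mr; rewrite /Qf; apply: measurable_fun_if => //.
- by apply: measurable_fun_ltr => //; exact: measurable_cst.
(* On the set where [r s] is positive the inverse is the real power with exponent -1, which is
   measurable on the whole line. *)
- apply: (@eq_measurable_fun _ _ _ _ _ (fun s => (p s ^+ 2 * (r s `^ (-1)))%:E)).
    move=> s; rewrite inE/= => -[_ /= r0]; congr EFin; congr (_ * _).
    by rewrite powR_inv1// ltW.
  apply: (@measurable_funS _ _ _ _ D) => //; apply/measurable_EFinP.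
  apply: measurable_funM; first exact: measurable_funX.
  by apply: (measurableT_comp (measurable_powR _)).
- apply: (@measurable_funS _ _ _ _ D) => //; apply: measurable_fun_if => //.
  by apply: measurable_fun_eqr => //; exact: measurable_cst.
Qed.

End Qfun.

(** * Energy along an admissible curve *)

Section Curve.
Variables (R : realType) (delta : R) (rho0 rho1 : int -> R) (rho w : R -> int -> R).
Hypothesis d0 : 0 < delta.
Hypothesis adm : admissible delta rho0 rho1 rho w.
Implicit Types (s : R) (k : int) (N : nat).
Local Notation mu := (@lebesgue_measure R).
Local Notation I01 := (`[0%R, 1%R]%classic : set R).
Local Notation D2 := (delta ^+ 2).

Let mI : measurable I01. Proof. exact: measurable_itv. Qed.

Let P s : 0 <= s <= 1 -> Pd2c delta (rho s).
Proof. by case: adm => + _ _ _ _; apply. Qed.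

Let wmeas k : measurable_fun I01 (fun s => w s k).
Proof. by case: adm => _ _ _ + _ => /(_ k)[]. Qed.

Let w2meas k : measurable_fun I01 (fun s => w s k ^+ 2).
Proof. by apply: measurable_funX; exact: wmeas. Qed.

Let muI : (mu I01 < +oo)%E.
Proof.
have := @lebesgue_measure_itv R `[0%R, 1%R]; rewrite /= lte_fin ltr01 => ->.
by rewrite -EFinD ltry.
Qed.

Lemma integrable_cst01 (c : R) : mu.-integrable I01 (EFin \o (fun=> c)).
Proof.
apply: (@measurable_bounded_integrable _ _ _ mu (fun=> c)) => //.
exists `|c|; split; first exact: num_real.
by move=> x cx y _; exact: ltW.
Qed.

Lemma curve_w_integrable k : mu.-integrable I01 (EFin \o (fun s => w s k)).
Proof.
have [_ _ _ /(_ k)[_ w2] _] := adm.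
have w2i : mu.-integrable I01 (EFin \o (fun s => w s k ^+ 2)).
  apply/integrableP; split; first by apply/measurable_EFinP; exact: w2meas.
  under eq_integral do rewrite /= ger0_norm ?sqr_ge0//.
  exact: w2.
have := @integrableD _ _ _ mu _ mI _ _ (integrable_cst01 1) w2i.
apply: le_integrable => //; first by apply/measurable_EFinP; exact: wmeas.
move=> s _ /=; rewrite lee_fin [leRHS]ger0_norm ?addr_ge0 ?sqr_ge0//.
rewrite ler_norml; have := sqr_ge0 (w s k - 1); have := sqr_ge0 (w s k + 1).
have := sqr_ge0 (w s k); rewrite !expr2 => *; apply/andP; split; nra.
Qed.

Lemma curve_prim k : prim (fun s => rho s k) (fun s => lapd delta (w s) k).
Proof.
apply: primP; last by case: adm => _ _ _ _ h s /h; apply.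
have i1 := @integrableD _ _ _ mu _ mI _ _ (curve_w_integrable (k + 1)) (curve_w_integrable (k - 1)).
have i2 := @integrableZl _ _ _ mu _ mI (- 2) _ (curve_w_integrable k).
have := @integrableZl _ _ _ mu _ mI (D2^-1) _ (@integrableD _ _ _ mu _ mI _ _ i1 i2).
apply: eq_integrable => // s _; rewrite /= /lapd; congr EFin; ring.
Qed.

Lemma curve_rho_measurable k : measurable_fun I01 (fun s => rho s k).
Proof. exact: prim_measurable (curve_prim k). Qed.

Definition sqsum s : \bar R := (\esum_(k in [set: int]) ((w s k) ^+ 2)%:E)%E.

Lemma sqsum_fin s : 0 <= s <= 1 -> sqsum s \is a fin_num.
Proof.
move=> s01; rewrite ge0_fin_numE; last by apply: esum_ge0 => k _; rewrite lee_fin sqr_ge0.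
by case: adm => _ _ + _ _; apply.
Qed.

(** From [|x| <= 1 + x^2] this bounds [|w s k|] for all [k] at once; it is integrable in [s] when
    the action is finite, and is the dominating function of every limit below. *)
Definition domi s : R := 1 + fine (sqsum s).

Lemma w_le_domi s k : 0 <= s <= 1 -> `|w s k| <= domi s.
Proof.
move=> s01; have := @term_le_esum _ (fun k => w s k ^+ 2) k (fun k => sqr_ge0 _).
rewrite -/(sqsum s) -(fineK (sqsum_fin s01)) lee_fin /domi => h.
rewrite ler_norml; have := sqr_ge0 (w s k - 1); have := sqr_ge0 (w s k + 1).
move: h; have := sqr_ge0 (w s k); rewrite !expr2 => *; apply/andP; split; nra.
Qed.

Lemma w_cvg0 s k : 0 <= s <= 1 -> w s (k - Posz n) @[n --> \oo] --> (0 : R).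
Proof.
move=> s01.
(* The shift by [k + 1] matches [Negz n = - (n + 1)], so that [k + 1 + Negz n] is [k - n]. *)
have f : (\esum_(j in [set: int]) ((fun j => w s (k + 1 + j) ^+ 2) j)%:E < +oo)%E.
  rewrite (esum_shift (k + 1) (fun j => (w s j ^+ 2)%:E)).
  by have := sqsum_fin s01; rewrite ge0_fin_numE//; apply: esum_ge0 => j _; rewrite lee_fin sqr_ge0.
have [_ c] := summable_terms_cvg0 (fun j => sqr_ge0 _) f.
have cs : Num.sqrt (w s (k + 1 + Negz n) ^+ 2) @[n --> \oo] --> Num.sqrt (0 : R).
  by apply: (cvg_comp _ _ c); exact: sqrt_continuous.
apply: (@norm_cvg0 _ R); rewrite -[X in _ --> X]sqrtr0.
move: cs; apply: cvg_trans; apply: near_eq_cvg; near=> n.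
by rewrite sqrtr_sqr; congr (`|w s _|); lia.
Unshelve. all: by end_near. Qed.

Lemma w_cvg0p s : 0 <= s <= 1 -> w s (Posz n.+1) @[n --> \oo] --> (0 : R).
Proof.
move=> s01.
have f : (\esum_(j in [set: int]) ((fun j => w s (1 + j) ^+ 2) j)%:E < +oo)%E.
  rewrite (esum_shift 1 (fun j => (w s j ^+ 2)%:E)).
  by have := sqsum_fin s01; rewrite ge0_fin_numE//; apply: esum_ge0 => j _; rewrite lee_fin sqr_ge0.
have [c _] := summable_terms_cvg0 (fun j => sqr_ge0 _) f.
have cs : Num.sqrt (w s (1 + Posz n) ^+ 2) @[n --> \oo] --> Num.sqrt (0 : R).
  by apply: (cvg_comp _ _ c); exact: sqrt_continuous.
apply: (@norm_cvg0 _ R); rewrite -[X in _ --> X]sqrtr0.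
move: cs; apply: cvg_trans; apply: near_eq_cvg; near=> n.
by rewrite sqrtr_sqr; congr (`|w s _|); rewrite -PoszD add1n.
Unshelve. all: by end_near. Qed.

Hypothesis act : (action delta rho w < +oo)%E.

Lemma action_sum_fin :
  (\esum_(k in [set: int]) \int[mu]_(s in I01) Qf (w s k) (rho s k) < +oo)%E.
Proof.
move: act; rewrite /action.
have : (0 <= \esum_(k in [set: int]) \int[mu]_(s in I01) Qf (w s k) (rho s k))%E.
  by apply: esum_ge0 => k _; apply: integral_ge0 => s _; exact: Qf_ge0.
case: (\esum_(k in _) _)%E => [x|_|//]; first by move=> *; exact: ltry.
by rewrite gt0_muley ?lte_fin.
Qed.

Lemma Qf_measurable k : measurable_fun I01 (fun s => Qf (w s k) (rho s k)).
Proof. by apply: measurable_Qf => //; exact: curve_rho_measurable. Qed.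

Lemma sqsum_integral_fin : (\int[mu]_(s in I01) sqsum s < +oo)%E.
Proof.
rewrite /sqsum integral_esum//; first last.
- by move=> k s _; rewrite lee_fin sqr_ge0.
- by move=> k; apply/measurable_EFinP; exact: w2meas.
have M0 : 0 < delta^-1 by rewrite invr_gt0.
apply: (@le_lt_trans _ _ (\esum_(k in [set: int]) ((delta^-1)%:E *
    \int[mu]_(s in I01) Qf (w s k) (rho s k)))%E).
  apply: le_esum => k _; rewrite -ge0_integralZl//; first last.
  - by rewrite lee_fin ltW.
  - by move=> s _; exact: Qf_ge0.
  - exact: Qf_measurable.
  apply: ge0_le_integral => //.
  - by move=> s _; rewrite lee_fin sqr_ge0.
  - by apply/measurable_EFinP; exact: w2meas.
  - by apply: emeasurable_funM => //; exact: Qf_measurable.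
  - move=> s /=; rewrite in_itv/= => s01; apply: sqr_le_Qf => //.
    by apply: Pd2c_le => //; exact: P.
rewrite esum_intZl ?(ltW M0)//; last by move=> k; apply: integral_ge0 => s _; exact: Qf_ge0.
by apply: lte_mul_pinfty; [rewrite lee_fin ltW| |exact: action_sum_fin].
Qed.

Lemma domi_integrable : mu.-integrable I01 (EFin \o domi).
Proof.
have m : measurable_fun I01 sqsum.
  apply: measurable_esum => //; first by move=> k; apply/measurable_EFinP; exact: w2meas.
  by move=> k s _; rewrite lee_fin sqr_ge0.
have s0 s : (0 <= sqsum s)%E by apply: esum_ge0 => k _; rewrite lee_fin sqr_ge0.
have si : mu.-integrable I01 sqsum.
  apply/integrableP; split=> //.
  by under eq_integral do rewrite gee0_abs//; exact: sqsum_integral_fin.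
have := @integrableD _ _ _ mu _ mI _ _ (integrable_cst01 1) si.
apply: eq_integrable => // s /set_mem/=; rewrite in_itv/= => s01.
by rewrite /domi EFinD fineK// sqsum_fin.
Qed.

Lemma domiZ_integrable c : mu.-integrable I01 (EFin \o (fun s => c * domi s)).
Proof. by have := @integrableZl _ _ _ mu _ mI c _ domi_integrable. Qed.

Local Notation cu s k := (cumul (rho s) k).
Local Notation m := (delta^-1).

Let r0 s k : 0 <= s <= 1 -> 0 <= rho s k.
Proof. by move=> /P h; exact: Pd2c_ge0 h. Qed.

(** Summing the laplacian over the sites up to [k] telescopes to a first difference at [k] minus one
    far to the left, which vanishes in the limit because [w s] is square summable. *)
Lemma cumul_prim k : prim (fun s => cu s k) (fun s => (w s (k + 1) - w s k) / D2).
Proof.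
pose f n s := \sum_(i < n) rho s (k - Posz i).
pose f' n s := \sum_(i < n) lapd delta (w s) (k - Posz i).
have f'E n s : f' n s = ((w s (k + 1) - w s k) - (w s (k + 1 - Posz n) - w s (k - Posz n))) / D2.
  rewrite /f'; elim: n => [|n IH]; first by rewrite big_ord0 !subr0 subrr mul0r.
  rewrite big_ord_recr/= IH /lapd.
  have -> : k + 1 - Posz n.+1 = k - Posz n by lia.
  have -> : k - Posz n + 1 = k + 1 - Posz n by lia.
  have -> : k - Posz n - 1 = k - Posz n.+1 by lia.
  by ring.
apply: (@prim_lim _ f f' _ _ (fun s => 4 / D2 * domi s)).
- move=> n; apply: (@prim_sum _ n (fun i s => rho s (k - Posz i))
    (fun i s => lapd delta (w s) (k - Posz i))) => i _.
  exact: curve_prim.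
- move=> s s01; have := @cumul_cvg _ _ _ (fun k => r0 k s01) (Pd2c_sum d0 (P s01)) k.
  apply: cvg_trans; apply: near_eq_cvg; near=> n.
  by rewrite /f /series/= big_mkord.
- move=> s s01.
  rewrite (_ : (fun n => f' n s) = (fun n => ((w s (k + 1) - w s k) -
    (w s (k + 1 - Posz n) - w s (k - Posz n))) / D2)); last by apply/funext => n; rewrite f'E.
  rewrite (_ : (w s (k + 1) - w s k) / D2 = (w s (k + 1) - w s k - (0 - 0)) / D2); last by rewrite !subr0.
  apply: cvgM; last exact: cvg_cst.
  apply: (@cvgB _ (R : normedModType R)); first exact: cvg_cst.
  by apply: (@cvgB _ (R : normedModType R)); exact: w_cvg0.
- exact: domiZ_integrable.
- move=> n s s01; rewrite f'E normrM normfV (ger0_norm (sqr_ge0 delta)) mulrAC.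
  rewrite ler_wpM2r ?invr_ge0 ?sqr_ge0//.
  apply: (le_trans (ler_normB _ _)).
  have h j : `|w s j| <= domi s by exact: w_le_domi.
  have := ler_normB (w s (k + 1)) (w s k).
  have := ler_normB (w s (k + 1 - Posz n)) (w s (k - Posz n)).
  by have := h k; have := h (k + 1); have := h (k + 1 - Posz n); have := h (k - Posz n); lra.
Unshelve. all: by end_near. Qed.

Lemma prim_window (f f' : R -> int -> R) N :
  (forall k, prim (fun s => f s k) (fun s => f' s k)) ->
  prim (fun s => window (f s) N) (fun s => window (f' s) N).
Proof.
move=> h; rewrite /window.
apply: (@prim_sum _ N (fun n s => f s (Posz n) + f s (Negz n)) (fun n s => f' s (Posz n) + f' s (Negz n))).
by move=> n _; apply: primD.
Qed.

Lemma window_integrable (f : R -> int -> R) N :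
  (forall k, mu.-integrable I01 (EFin \o (fun s => f s k))) ->
  mu.-integrable I01 (EFin \o (fun s => window (f s) N)).
Proof.
move=> h; have -> : EFin \o (fun s => window (f s) N) =
    (fun s => \sum_(n <- index_enum 'I_N) ((f s (Posz n))%:E + (f s (Negz n))%:E)%E)%E.
  by apply/funext => s /=; rewrite /window -sumEFin.
apply: (@integrable_sum _ _ _ mu _ mI) => n _.
exact: (@integrableD _ _ _ mu _ mI _ _ (h _) (h _)).
Qed.

(** The derivative of [x * (m - x)] at [x = cu s k]. *)
Let A s k := m - 2 * cu s k.

Let A_le s k : 0 <= s <= 1 -> `|A s k| <= m.
Proof.
move=> s01; have c0 := cumul_ge0 (fun k => r0 k s01) (Pd2c_sum d0 (P s01)) k.
have c1 := cumul_le (fun k => r0 k s01) (Pd2c_sum d0 (P s01)) k.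
by rewrite /A ler_norml; apply/andP; split; lra.
Qed.

Let A_meas k : measurable_fun I01 (fun s => A s k).
Proof.
apply: measurable_funB => //; apply: measurable_funM => //.
exact: prim_measurable (cumul_prim k).
Qed.

Lemma pair_prim k : prim (fun s => cu s k * (m - cu s k))
  (fun s => A s k * (w s (k + 1) - w s k) / D2).
Proof.
have p1 := cumul_prim k; have p2 := primD (prim_cst m) (primZ (-1) p1).
apply: eq_prim (primM p1 p2) => s _; first by congr (_ * _); ring.
by rewrite /A; ring.
Qed.

(** Boundary terms of the summation by parts. Taking [A] one site to the left of the window, at
    [Negz N.+1], lets the remaining sum of [w * rho] run over the whole window. *)
Let bd N s := A s (Posz N) * w s (Posz N.+1) - A s (Negz N.+1) * w s (Negz N).

(* Abel summation, with [A_k - A_{k-1} = - 2 rho_k]. *)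
Lemma window_abel N s : 0 <= s <= 1 ->
  window (fun k => A s k * (w s (k + 1) - w s k) / D2) N.+1 =
  (2 * window (fun k => w s k * rho s k) N.+1 + bd N s) / D2.
Proof.
move=> s01; have cr := cumul_rec (fun k => r0 k s01) (Pd2c_sum d0 (P s01)).
rewrite /window; elim: N => [|N IH].
  rewrite !big_ord_recl !big_ord0 !addr0/= /bd /A.
  have -> : (Posz 0 + 1)%R = Posz 1 by [].
  have -> : (Negz 0 + 1)%R = Posz 0 by [].
  have := cr (Posz 0); have := cr (Negz 0).
  have -> : (Posz 0 - 1)%R = Negz 0 by [].
  have -> : (Negz 0 - 1)%R = Negz 1 by [].
  by move=> -> ->; ring.
rewrite big_ord_recr/= IH [in RHS]big_ord_recr/= /bd /A.
have -> : (Posz N.+1 + 1)%R = Posz N.+2 by rewrite -PoszD addn1.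
have -> : (Negz N.+1 + 1)%R = Negz N by lia.
have := cr (Posz N.+1); have := cr (Negz N.+1).
have -> : (Posz N.+1 - 1)%R = Posz N by lia.
have -> : (Negz N.+1 - 1)%R = Negz N.+2 by lia.
by move=> -> ->; ring.
Qed.

Let bd_integrable N : mu.-integrable I01 (EFin \o bd N).
Proof.
have h j k : mu.-integrable I01 (EFin \o (fun s => A s k * w s j)).
  have := @integrableM_bounded _ (fun s => w s j) (fun s => A s k) m (A_meas k)
    (fun s => @A_le s k) (curve_w_integrable j).
  by apply: eq_integrable => // s _; rewrite /= mulrC.
have := @integrableB _ _ _ mu _ mI _ _ (h (Posz N.+1) (Posz N)) (h (Negz N) (Negz N.+1)).
by apply: eq_integrable => // s _.
Qed.

Let bd_le N s : 0 <= s <= 1 -> `|bd N s| <= 2 * m * domi s.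
Proof.
move=> s01; rewrite /bd; apply: (le_trans (ler_normB _ _)); rewrite !normrM.
have h j k := ler_pM (normr_ge0 _) (normr_ge0 _) (@A_le s k s01) (w_le_domi j s01).
have := h (Posz N.+1) (Posz N); have := h (Negz N) (Negz N.+1); lra.
Qed.

Let bd_cvg0 s : 0 <= s <= 1 -> bd N s @[N --> \oo] --> (0 : R).
Proof.
move=> s01; apply: (@norm_cvg0 _ R).
have c1 := w_cvg0p s01; have c2 := @w_cvg0 s (-1) s01.
have c : m * `|w s (Posz n.+1)| + m * `|w s (-1 - Posz n)| @[n --> \oo] --> (0 : R).
  rewrite -[X in _ --> X](_ : m * `|0 : R| + m * `|0 : R| = 0); last by rewrite normr0 mulr0 addr0.
  by apply: (@cvgD _ (R : normedModType R)); (apply: cvgM; [exact: cvg_cst|exact: cvg_norm]).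
apply: (squeeze_cvgr _ (cvg_cst (0 : R)) c); near=> n; rewrite normr_ge0/=.
rewrite /bd; apply: (le_trans (ler_normB _ _)); rewrite !normrM.
have -> : -1 - Posz n = Negz n by lia.
by apply: lerD; apply: ler_wpM2r => //; exact: A_le.
Unshelve. all: by end_near. Qed.

Let bd_int_cvg0 : \int[mu]_(s in I01) bd N s @[N --> \oo] --> (0 : R).
Proof.
have [] := @dominated_convergence _ _ _ mu _ mI (fun n s => (bd n s)%:E) (cst 0%E)
  (EFin \o (fun s => 2 * m * domi s)).
- by move=> n; exact: measurable_int (bd_integrable n).
- exact: measurable_cst.
- apply/aeW => s /=; rewrite in_itv/= => s01.
  by apply: cvg_EFin; [near=> n|exact: bd_cvg0].
- exact: domiZ_integrable.
- by apply/aeW => s n /=; rewrite in_itv/= => s01; rewrite lee_fin bd_le.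
by move=> _ _; rewrite integral0 => /fine_cvg.
Unshelve. all: by end_near. Qed.

Lemma wrho_integrable k : mu.-integrable I01 (EFin \o (fun s => w s k * rho s k)).
Proof.
apply: (@integrableM_bounded _ _ _ m); [exact: curve_rho_measurable| |exact: curve_w_integrable].
move=> s s01; rewrite ger0_norm ?r0//.
by apply: Pd2c_le => //; exact: P.
Qed.

(** [window_abel] integrated in [s]; the boundary terms vanish by dominated convergence. The limit
    of windows is kept because [w * rho] has no sign, and because the action is also compared window
    by window in [evolved_action_le]. *)
Lemma energy_cvg :
  delta * \int[mu]_(s in I01) window (fun k => w s k * rho s k) n.+1 @[n --> \oo] -->
  energyR delta rho0 - energyR delta rho1.
Proof.
have [_ [e0 e1] _ _ _] := adm.
have s0 : 0 <= (0 : R) <= 1 by rewrite lexx ler01.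
have s1 : 0 <= (1 : R) <= 1 by rewrite lexx ler01.
pose X s N := window (fun k => cu s k * (m - cu s k)) N.
have XE N : X 1 N.+1 - X 0 N.+1 = (2 * \int[mu]_(s in I01) window (fun k => w s k * rho s k) N.+1 +
    \int[mu]_(s in I01) bd N s) / D2.
  have [_ /(_ 1 s1)] := prim_window N.+1 pair_prim.
  rewrite -/(X 1 N.+1) -/(X 0 N.+1) => ->; rewrite addrAC subrr add0r.
  have wi := window_integrable N.+1 wrho_integrable.
  have wi2 := @integrableZl _ _ _ mu _ mI 2 _ wi.
  have bi := bd_integrable N.
  rewrite -RintegralZl// -RintegralD// -RintegralZr//; last first.
    by have := @integrableD _ _ _ mu _ mI _ _ wi2 bi.
  by apply: eq_Rintegral => s /set_mem/=; rewrite in_itv/= => s01; rewrite window_abel.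
have D2n : D2 != 0 by rewrite gt_eqF// exprn_gt0.
have -> : (fun n => delta * \int[mu]_(s in I01) window (fun k => w s k * rho s k) n.+1) =
   (fun n => (- (delta ^+ 3 / 2) * X 0 n.+1 - - (delta ^+ 3 / 2) * X 1 n.+1) -
     delta / 2 * \int[mu]_(s in I01) bd n s).
  apply/funext => n; have := XE n.
  set I1 := \int[mu]_(s in _) window _ _; set I2 := \int[mu]_(s in _) bd _ _.
  move=> /(congr1 (fun x => x * D2)); rewrite mulfVK// => e.
  have -> : I1 = ((X 1 n.+1 - X 0 n.+1) * D2 - I2) / 2 by rewrite e; field.
  by field.
rewrite -[X in _ --> X]subr0; apply: (@cvgB _ (R : normedModType R)); last first.
  rewrite -[X in _ --> X](mulr0 (delta / 2)).
  by apply: cvgM; [exact: cvg_cst|exact: bd_int_cvg0].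
apply: (@cvgB _ (R : normedModType R)).
  have := energyR_cvg d0 (P s0); rewrite e0 -(cvg_shiftS (fun n => _ * window _ n)).
  by rewrite /X e0.
have := energyR_cvg d0 (P s1); rewrite e1 -(cvg_shiftS (fun n => _ * window _ n)).
by rewrite /X e1.
Qed.

End Curve.

(** * The evolved curve *)

Section FlowFacts.
Variables (R : realType) (delta : R) (S : R -> (int -> R) -> (int -> R)).
Hypotheses (d0 : 0 < delta) (hS : pme_semigroup delta S).
Variable rho : int -> R.
Hypothesis rP : Pd2c delta rho.
Implicit Types (t : R) (k : int).
Local Notation m := (delta^-1).

Lemma flow_Pd2c t : 0 <= t -> Pd2c delta (S t rho).
Proof. by have [h _ _ _ _] := hS rP; exact: h. Qed.

Lemma flow_bounds t k : 0 <= t -> 0 <= S t rho k <= m.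
Proof. by move=> /flow_Pd2c h; rewrite (Pd2c_ge0 _ h) Pd2c_le. Qed.

Lemma flow_derive k t : 0 < t ->
  is_derive t (1 : R) (fun t => S t rho k) (lapd delta (sqz (S t rho)) k).
Proof. by have [_ _ _ _ h] := hS rP; exact: h. Qed.

Lemma flow_continuous k T : {within `[0%R, T], continuous (fun t => S t rho k)}.
Proof.
have [_ _ _ h _] := hS rP; apply: continuous_subspaceW (h k).
by move=> x /=; rewrite !in_itv/= andbT => /andP[].
Qed.

Lemma flow0 : S 0 rho = rho.
Proof. by have [_ h _ _ _] := hS rP. Qed.

(** A zero at a positive time is an interior minimum in time of a nonnegative function, so its time
    derivative vanishes; the equation then equates the sum of the squared neighbours to 0. *)
Lemma flow_zero_neighbours t k : 0 < t -> S t rho k = 0 ->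
  S t rho (k + 1) = 0 /\ S t rho (k - 1) = 0.
Proof.
move=> t0 y0; have D := flow_derive k t0.
have D0 : is_derive t (1 : R) (fun t => S t rho k) 0.
  apply: (@derive1_at_min _ _ 0 (2 * t)).
  - by rewrite mulr_ge0// ltW.
  - move=> x; rewrite in_itv/= => /andP[x0 _].
    by have [] := flow_derive k x0.
  - by rewrite in_itv/= t0/=; lra.
  - move=> x; rewrite in_itv/= y0 => /andP[/ltW x0 _].
    by have /andP[] := flow_bounds k x0.
have e : lapd delta (sqz (S t rho)) k = 0.
  by have [_ <-] := D; have [_ ->] := D0.
have e' : S t rho (k + 1) ^+ 2 + S t rho (k - 1) ^+ 2 = 0.
  move: e; rewrite /lapd /sqz y0 expr0n/= mulr0 subr0 => /eqP.
  by rewrite mulf_eq0 invr_eq0 expf_eq0/= (gt_eqF d0) orbF => /eqP.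
have h1 := sqr_ge0 (S t rho (k + 1)); have h2 := sqr_ge0 (S t rho (k - 1)).
by split; apply/eqP; rewrite -sqrf_eq0 eq_le; apply/andP; split=> //; lra.
Qed.

(** A single zero would spread to all sites and contradict the unit mass. *)
Lemma flow_pos t k : 0 < t -> 0 < S t rho k.
Proof.
move=> t0; rewrite lt_neqAle; have /andP[-> _] := flow_bounds k (ltW t0).
rewrite andbT; apply/eqP => /esym y0.
have z n : S t rho (k + Posz n) = 0 /\ S t rho (k - Posz n) = 0.
  elim: n => [|n [IH1 IH2]].
    by split; rewrite -[RHS]y0; congr (S t rho _); lia.
  have -> : k + Posz n.+1 = k + Posz n + 1 by lia.
  have -> : k - Posz n.+1 = k - Posz n - 1 by lia.
  by have [-> _] := flow_zero_neighbours t0 IH1; have [_ ->] := flow_zero_neighbours t0 IH2.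
have zero j : S t rho j = 0.
  have [kj|jk] := leP k j.
    by have [+ _] := z `|j - k|%N; have -> : k + Posz `|j - k|%N = j by lia.
  by have [_ +] := z `|j - k|%N; have -> : k - Posz `|j - k|%N = j by lia.
have := Pd2c_sum d0 (flow_Pd2c (ltW t0)).
rewrite esum1; last by move=> j _; rewrite zero.
by move=> [] /esym/eqP; rewrite invr_eq0 (gt_eqF d0).
Qed.

End FlowFacts.

Section EvolvedCurve.
Variables (R : realType) (delta : R) (S : R -> (int -> R) -> (int -> R)).
Hypotheses (d0 : 0 < delta) (hS : pme_semigroup delta S).
Variables (rho0 rho1 : int -> R) (rho w : R -> int -> R).
Hypothesis adm : admissible delta rho0 rho1 rho w.
Hypothesis act : (action delta rho w < +oo)%E.
Variable h : R.
Local Notation m := (delta^-1).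
Local Notation rt := (rate delta m).
Hypotheses (h0 : 0 < h) (hsmall : rt * h <= 1 / 16).
Implicit Types (s t : R) (k j : int) (n : nat).
Local Notation mu := (@lebesgue_measure R).
Local Notation I01 := (`[0%R, 1%R]%classic : set R).

Definition etime s : R := h * (1 - s).
Definition erho s : int -> R := S (etime s) (rho s).
Definition eU s k : R := uflow delta (rho s) (w s) (etime s) k.
(** The second term is the chain rule in the flow time: [etime] has derivative [- h], and the flow
    moves the density by the laplacian of its square. *)
Definition ew s k : R := eU s k - h * erho s k ^+ 2.

Let m0 : 0 < m. Proof. by rewrite invr_gt0. Qed.
Let rt0 : 0 < rt. Proof. by rewrite /rate divr_gt0 ?exprn_gt0// mulr_gt0. Qed.
Let mI : measurable I01. Proof. exact: measurable_itv. Qed.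
Let P s : 0 <= s <= 1 -> Pd2c delta (rho s).
Proof. by case: adm => + _ _ _ _; apply. Qed.

Let rM s : 0 <= s <= 1 -> forall k, `|rho s k| <= m.
Proof.
by move=> /P p k; rewrite ger0_norm ?(Pd2c_ge0 _ p)// Pd2c_le.
Qed.

Lemma etime_ge0 s : 0 <= s <= 1 -> 0 <= etime s.
Proof. by move=> /andP[_ s1]; rewrite mulr_ge0 ?(ltW h0)// subr_ge0. Qed.

Lemma etime_le s : 0 <= s <= 1 -> etime s <= h.
Proof. by move=> /andP[s0 _]; rewrite ger_pMr// gerBl. Qed.

Let rtau s : 0 <= s <= 1 -> 0 <= rt * etime s <= 1 / 16.
Proof.
move=> s01; rewrite mulr_ge0 ?(ltW rt0) ?etime_ge0//=.
by apply: le_trans hsmall; rewrite ler_wpM2l ?(ltW rt0)// etime_le.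
Qed.

Let small s : 0 <= s <= 1 -> rt * `|etime s| <= 1 / 8.
Proof. by move=> s01; rewrite ger0_norm ?etime_ge0//; have := rtau s01; lra. Qed.

Lemma erho_aflow s k : 0 <= s <= 1 -> erho s k = aflow delta (rho s) (etime s) k.
Proof.
move=> s01; apply: (@aflow_unique _ _ m d0 m0 _ (rM s01) (fun t => S t (rho s)) h) => //.
- move=> t j /andP[t0 _]; have /andP[a b] := flow_bounds d0 hS (P s01) j t0.
  by rewrite ger0_norm.
- by move=> j; rewrite (flow0 hS (P s01)).
- by move=> j; exact: (flow_continuous hS (P s01)).
- by move=> j t /andP[t0 _]; exact: (flow_derive hS (P s01)).
- by rewrite etime_ge0// etime_le.
Qed.

Lemma erho_Pd2c s : 0 <= s <= 1 -> Pd2c delta (erho s).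
Proof. by move=> s01; apply: (flow_Pd2c hS (P s01)); exact: etime_ge0. Qed.

Let dm s : 0 <= s <= 1 -> forall k, `|w s k| <= domi w s.
Proof. by move=> s01 k; exact: (w_le_domi adm). Qed.

Let dm0 s : 0 <= s <= 1 -> 0 <= domi w s.
Proof. by move=> s01; exact: le_trans (dm s01 0). Qed.

Let dm2 s : 0 <= s <= 1 -> domi w s <= 2 * domi w s.
Proof. by move=> /dm0; lra. Qed.

Lemma prim_lapd (f f' : R -> int -> R) k :
  (forall j, prim (fun s => f s j) (fun s => f' s j)) ->
  prim (fun s => lapd delta (f s) k) (fun s => lapd delta (f' s) k).
Proof.
move=> pf; have p := primZ (delta ^+ 2)^-1 (primD (primD (pf (k + 1)) (pf (k - 1))) (primZ (- 2) (pf k))).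
by apply: eq_prim p => s _; rewrite /lapd; ring.
Qed.

(** Linearisation at the level of coefficients: the product rule applied to the Cauchy square in
    [acoefS] gives twice the mixed convolution, which is the recursion [ucoefS]. *)
Lemma acoef_prim n k : prim (fun s => acoef delta (rho s) n k)
  (fun s => lapd delta (ucoef delta (rho s) (w s) n) k).
Proof.
elim/ltn_ind: n k => -[|n] IH k; first exact: (curve_prim adm).
have pj j : prim (fun s => \sum_(i < n.+1) acoef delta (rho s) i j * acoef delta (rho s) (n - i)%N j)
    (fun s => n.+1%:R * ucoef delta (rho s) (w s) n.+1 j).
  apply: (@eq_prim _ _ (fun s => \sum_(i < n.+1)
     (lapd delta (ucoef delta (rho s) (w s) i) j * acoef delta (rho s) (n - i)%N j +
      lapd delta (ucoef delta (rho s) (w s) (n - i)%N) j * acoef delta (rho s) i j)) _ _ (fun s _ => erefl)).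
    (* Reversing the index shows that the two halves of the product rule agree, which accounts for
       the factor 2. *)
    move=> s _; rewrite ucoefS big_split/= [X in X + _ = _](reindex_inj rev_ord_inj)/=.
    rewrite mulr_natl mulr2n; congr (_ + _); apply: eq_bigr => i _.
      by rewrite subSS subKn -1?ltnS// mulrC.
    by rewrite mulrC.
  apply: (@prim_sum _ n.+1 (fun i s => acoef delta (rho s) i j * acoef delta (rho s) (n - i)%N j)
    (fun i s => lapd delta (ucoef delta (rho s) (w s) i) j * acoef delta (rho s) (n - i)%N j +
      lapd delta (ucoef delta (rho s) (w s) (n - i)%N) j * acoef delta (rho s) i j)) => i ni.
  by apply: primM; apply: IH => //; rewrite ltnS leq_subr.
have := primZ (n.+1%:R^-1) (@prim_lapd _ _ k pj).
apply: eq_prim => s _; first by rewrite -acoefS mulKf// pnatr_eq0.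
by rewrite lapdZ mulKf// pnatr_eq0.
Qed.

Lemma acoef_measurable n k : measurable_fun I01 (fun s => acoef delta (rho s) n k).
Proof. exact: prim_measurable (acoef_prim n k). Qed.

Lemma ucoef_measurable n k : measurable_fun I01 (fun s => ucoef delta (rho s) (w s) n k).
Proof.
elim/ltn_ind: n k => -[|n] IH k; first by case: adm => _ _ _ /(_ k)[].
have -> : (fun s => ucoef delta (rho s) (w s) n.+1 k) = (fun s => n.+1%:R^-1 *
    (2 * \sum_(i < n.+1) acoef delta (rho s) i k * lapd delta (ucoef delta (rho s) (w s) (n - i)%N) k)).
  by apply/funext => s; rewrite -ucoefS mulKf// pnatr_eq0.
apply: measurable_funM => //; apply: measurable_funM => //.
apply: measurable_sum => i; apply: measurable_funM; first exact: acoef_measurable.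
have l : (n - i < n.+1)%N by rewrite ltnS leq_subr.
rewrite /lapd; apply: measurable_funM => //; apply: measurable_funB.
  by apply: measurable_funD; exact: IH.
by apply: measurable_funM => //; exact: IH.
Qed.

Lemma etime_prim : prim etime (fun=> - h).
Proof.
have := primZ h (primD (prim_cst 1) (primZ (-1) (@prim_id R))).
by apply: eq_prim => s _; rewrite /etime; ring.
Qed.

Lemma etimeX_prim n : prim (fun s => etime s ^+ n) (fun s => - h * (n%:R * etime s ^+ n.-1)).
Proof.
elim: n => [|n IH].
  by apply: eq_prim (prim_cst 1) => s _; rewrite ?mul0r ?mulr0.
apply: eq_prim (primM etime_prim IH) => s _; first by rewrite exprS.
case: n {IH} => [|n]; first by rewrite /= !expr0; ring.
by rewrite /= exprS -[n.+2%:R]natr1; ring.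
Qed.

Lemma eU_measurable k : measurable_fun I01 (fun s => eU s k).
Proof.
apply: (@measurable_fun_cvg _ _ _ _ (fun n s => pseries (fun i => ucoef delta (rho s) (w s) i k) (etime s) n)).
  move=> n; rewrite (_ : (fun s => _) = (fun s =>
    \sum_(i < n) ucoef delta (rho s) (w s) i k * etime s ^+ i)); last first.
    by apply/funext => s; rewrite /pseries /series/= big_mkord.
  apply: measurable_sum => i; apply: measurable_funM; first exact: ucoef_measurable.
  exact: prim_measurable (etimeX_prim i).
move=> s /=; rewrite in_itv/= => s01.
(* Only convergence is at stake, so the weight may be constant in [k]; summability over [k] is not
   asked of it. *)
exact: (@uflow_cvg _ _ m d0 m0 _ (rM s01) _ (fun=> domi w s) (dm s01) (fun=> dm2 s01) (fun=> dm2 s01) _ k (small s01)).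
Qed.

Lemma lapd_eU_cvg s k : 0 <= s <= 1 ->
  \sum_(n < N) lapd delta (ucoef delta (rho s) (w s) n) k * etime s ^+ n @[N --> \oo] -->
  lapd delta (eU s) k.
Proof.
move=> s01.
have c j := @uflow_cvg _ _ m d0 m0 _ (rM s01) _ (fun=> domi w s) (dm s01) (fun=> dm2 s01) (fun=> dm2 s01) _ j (small s01).
have := @cvg_lapd _ delta _ _ k c; apply: cvg_trans; apply: near_eq_cvg; near=> n.
transitivity (lapd delta (fun j => \sum_(i < n) ucoef delta (rho s) (w s) i j * etime s ^+ i) k).
  by congr (lapd _ _ _); apply/funext => j; rewrite /pseries /series/= big_mkord.
rewrite -lapd_sum; apply: eq_bigr => i _; rewrite mulrC -lapdZ; congr (lapd _ _ _).
by apply/funext => j; rewrite mulrC.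
Unshelve. all: by end_near. Qed.

(** The power series is differentiated term by term in [s]: [t1] comes from the coefficients and
    sums to [lapd] of [eU], [t2] comes from the powers of [etime] and sums to the contribution of
    [- h * erho ^+ 2]. In the dominating function, [12] is twice the 6 of [lapd_ucoef_le], and
    [2 * m] bounds the [t2] part. *)
Lemma erho_prim k : prim (fun s => erho s k) (fun s => lapd delta (ew s) k).
Proof.
pose f N s := \sum_(n < N) acoef delta (rho s) n k * etime s ^+ n.
pose t1 n s := lapd delta (ucoef delta (rho s) (w s) n) k * etime s ^+ n.
pose t2 n s := - h * (n%:R * etime s ^+ n.-1) * acoef delta (rho s) n k.
pose f' N s := \sum_(n < N) (t1 n s + t2 n s).
apply: (@prim_lim _ f f' _ _ (fun s => 12 / delta ^+ 2 * domi w s + 2 * m)).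
- move=> N; apply: (@prim_sum _ N (fun n s => acoef delta (rho s) n k * etime s ^+ n) (fun n s => t1 n s + t2 n s)).
  by move=> n _; apply: primM; [exact: acoef_prim|exact: etimeX_prim].
- move=> s s01; rewrite erho_aflow//.
  have := @aflow_cvg _ _ m d0 m0 _ (rM s01) _ k (small s01).
  apply: cvg_trans; apply: near_eq_cvg; near=> n.
  by rewrite /f /pseries /series/= big_mkord.
- move=> s s01.
  have -> : lapd delta (ew s) k = lapd delta (eU s) k + - h * lapd delta (sqz (erho s)) k.
    rewrite (_ : ew s = fun j => eU s j - h * sqz (erho s) j)//.
    by rewrite lapdB lapdZ mulNr.
  have -> : (fun N => f' N s) = (fun N => \sum_(n < N) t1 n s + \sum_(n < N) t2 n s).
    by apply/funext => N; rewrite /f' big_split.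
  apply: (@cvgD _ (R : normedModType R)); first exact: lapd_eU_cvg.
  rewrite -(cvg_shiftS (fun N => \sum_(n < N) t2 n s)).
  have -> : sqz (erho s) = sqz (aflow delta (rho s) (etime s)).
    by apply/funext => j; rewrite /sqz erho_aflow.
  have c : - h * pseries (pseries_diffs (acoef delta (rho s) ^~ k)) (etime s) N @[N --> \oo] -->
      - h * lapd delta (sqz (aflow delta (rho s) (etime s))) k.
    apply: cvgM; first exact: cvg_cst.
    exact: (@adiffs_cvg _ _ m d0 m0 _ (rM s01) _ k (small s01)).
  move: c; apply: cvg_trans; apply: near_eq_cvg; near=> n.
  rewrite /= big_ord_recl/=; have -> : t2 0%N s = 0 by rewrite /t2 mul0r mulr0 mul0r.
  rewrite add0r /pseries /series/= big_mkord mulr_sumr.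
  by apply: eq_bigr => i _; rewrite /t2 /pseries_diffs /bump/= add1n; ring.
- have := @integrableD _ _ _ mu _ mI _ _ (domiZ_integrable d0 adm act (12 / delta ^+ 2)) (integrable_cst01 (2 * m)).
  by apply: eq_integrable => // s _.
- move=> N s s01; rewrite /f' big_split/=.
  apply: (le_trans (ler_normD _ _)); apply: lerD.
    have -> : 12 / delta ^+ 2 * domi w s = 2 * (6 * domi w s / delta ^+ 2) by ring.
    apply: (@geometric_sum_le _ (t1 ^~ s) _ (rt * `|etime s|)).
      by rewrite ger0_norm ?etime_ge0//; have := rtau s01; lra.
    apply: geometric_scale => n.
    exact: (@lapd_ucoef_le _ _ m d0 m0 _ (rM s01) _ (fun=> domi w s) (dm s01) (fun=> dm2 s01) (fun=> dm2 s01)).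
  (* Replacing [etime s] by [h] turns the term into [m] times [(rt * h)] to its index, times a
     factor below a power of 2; with [rt * h <= 1 / 16] the ratio is [2 / 16]. *)
  apply: (@geometric_sum_le _ (t2 ^~ s) _ (1 / 8)); first by lra.
  case=> [|n]; first by rewrite /t2 !mul0r mulr0 mul0r normr0 mulr_ge0// ?exprn_ge0 ?(ltW m0)//; lra.
  rewrite /t2 /= !normrM normrN (gtr0_norm h0) (ger0_norm (ler0n _ _)).
  rewrite (ger0_norm (exprn_ge0 _ (etime_ge0 s01))).
  have a := acoef_le d0 m0 (rM s01) n.+1 k.
  apply: (@le_trans _ _ (h * (2 ^+ n * h ^+ n) * (m * rt ^+ n.+1))).
    apply: ler_pM => //.
    - by rewrite !mulr_ge0 ?exprn_ge0 ?etime_ge0// ltW.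
    - rewrite ler_wpM2l ?(ltW h0)//; apply: ler_pM => //.
      + by rewrite exprn_ge0 ?etime_ge0.
      + exact: natr_le_pow2.
      + by apply: lerXn2r; rewrite ?nnegrE ?etime_ge0 ?(ltW h0) ?etime_le.
  have -> : h * (2 ^+ n * h ^+ n) * (m * rt ^+ n.+1) = m * (2 ^+ n * (rt * h) ^+ n.+1).
    by rewrite [(rt * h) ^+ _]exprMn (exprS h n); ring.
  rewrite ler_wpM2l ?(ltW m0)//.
  apply: (@le_trans _ _ (2 ^+ n.+1 * (1 / 16) ^+ n.+1)).
    have rth : 0 <= rt * h by apply: mulr_ge0; exact: ltW.
    move: (rt * h) rth hsmall => x x0 x1; apply: ler_pM.
    - exact: exprn_ge0.
    - exact: exprn_ge0.
    - by rewrite exprS ler_peMl ?exprn_ge0//; lra.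
    - by apply: lerXn2r => //; rewrite nnegrE; lra.
  by rewrite -exprMn le_eqVlt; apply/orP; left; apply/eqP; congr (_ ^+ _); field.
Unshelve. all: by end_near. Qed.

End EvolvedCurve.

(** The cross term is written with the shifted potential [p - h * r ^+ 2], because this one belongs
    to the evolved curve and so integrates to an energy difference. The remainder [h ^+ 2 * r ^+ 3]
    then has the favourable sign. *)
Lemma Qf_shift (R : realType) (p r h : R) : 0 <= r ->
  (Qf (p - h * r ^+ 2) r + (2 * h * ((p - h * r ^+ 2) * r) + h ^+ 2 * r ^+ 3)%:E = Qf p r)%E.
Proof.
rewrite le_eqVlt => /predU1P[<-|r0].
  by rewrite expr0n/= !mulr0 subr0 expr0n/= mulr0 addr0 adde0.
by rewrite /Qf r0 -EFinD; congr EFin; field; rewrite gt_eqF.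
Qed.

(** A crude bound free of the signed cross term: it yields finite action for the evolved curve,
    without which the exact identity cannot be integrated. *)
Lemma Qf_shift_le (R : realType) (p r h : R) : 0 <= r ->
  (Qf (p - h * r ^+ 2) r <= 2%:E * Qf p r + (2 * h ^+ 2 * r ^+ 3)%:E)%E.
Proof.
rewrite le_eqVlt => /predU1P[<-|r0].
  rewrite expr0n/= !mulr0 subr0 expr0n/= mulr0 adde0 -[leLHS]mul1e.
  by apply: lee_wpmul2r; rewrite ?Qf_ge0// lee_fin; lra.
rewrite /Qf r0 -EFinM -EFinD lee_fin -subr_ge0.
have -> : 2 * (p ^+ 2 / r) + 2 * h ^+ 2 * r ^+ 3 - (p - h * r ^+ 2) ^+ 2 / r =
    (p + h * r ^+ 2) ^+ 2 / r by field; rewrite gt_eqF.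
by rewrite divr_ge0 ?sqr_ge0// ltW.
Qed.

(** Finiteness excludes a nonzero potential at a vacuum site. As division by zero returns 0, the
    real quotient then agrees with [Qf] at [r = 0] as well. *)
Lemma Qf_real (R : realType) (p r : R) : 0 <= r -> (Qf p r < +oo)%E ->
  (r = 0 -> p = 0) /\ Qf p r = (p ^+ 2 / r)%:E.
Proof.
rewrite le_eqVlt => /predU1P[<-|r0] /=.
  by rewrite /Qf ltxx; case: eqP => // -> _; rewrite expr0n/= mul0r.
by rewrite /Qf r0 => _; split=> // e; move: r0; rewrite e ltxx.
Qed.

(** * Action and admissibility of the evolved curve *)

Section EvolvedAction.
Variables (R : realType) (delta : R) (S : R -> (int -> R) -> (int -> R)).
Hypotheses (d0 : 0 < delta) (hS : pme_semigroup delta S).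
Variables (rho0 rho1 : int -> R) (rho w : R -> int -> R).
Hypothesis adm : admissible delta rho0 rho1 rho w.
Hypothesis act : (action delta rho w < +oo)%E.
Variable h : R.
Local Notation m := (delta^-1).
Local Notation rt := (rate delta m).
Hypotheses (h0 : 0 < h) (hsmall : rt * h <= 1 / 16).
Implicit Types (s t : R) (k j : int) (n : nat).
Local Notation mu := (@lebesgue_measure R).
Local Notation I01 := (`[0%R, 1%R]%classic : set R).
Local Notation tau := (etime h).
Local Notation rh := (erho S rho h).
Local Notation U := (eU delta rho w h).
Local Notation wh := (ew delta S rho w h).

Let m0 : 0 < m. Proof. by rewrite invr_gt0. Qed.
Let rt0 : 0 < rt. Proof. by rewrite /rate divr_gt0 ?exprn_gt0// mulr_gt0. Qed.
Let mI : measurable I01. Proof. exact: measurable_itv. Qed.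
Let P s : 0 <= s <= 1 -> Pd2c delta (rho s).
Proof. by case: adm => + _ _ _ _; apply. Qed.
Let Ph s : 0 <= s <= 1 -> Pd2c delta (rh s).
Proof. exact: (erho_Pd2c hS adm h0). Qed.
Let rh0 s k : 0 <= s <= 1 -> 0 <= rh s k.
Proof. by move=> /Ph p; exact: Pd2c_ge0 p. Qed.
Let rhm s k : 0 <= s <= 1 -> rh s k <= m.
Proof. by move=> /Ph p; exact: Pd2c_le p. Qed.

Let rM s : 0 <= s <= 1 -> forall k, `|rho s k| <= m.
Proof. by move=> /P p k; rewrite ger0_norm ?(Pd2c_ge0 _ p)// Pd2c_le. Qed.

Let w2 s : 0 <= s <= 1 -> (\esum_(k in [set: int]) ((w s k) ^+ 2)%:E < +oo)%E.
Proof. by case: adm => _ _ + _ _; apply. Qed.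

Definition dens s : \bar R := (\esum_(k in [set: int]) Qf (w s k) (rho s k))%E.

Lemma evolved_contraction s : 0 <= s <= 1 ->
  (\esum_(k in [set: int]) Qf (U s k) (rh s k) <= dens s)%E.
Proof.
move=> s01; have [_ s1] := andP s01.
have dens0 : (0 <= dens s)%E by apply: esum_ge0 => k _; exact: Qf_ge0.
(* At [s = 1] the flow time is 0 and nothing moves, while [flow_contraction] asks for a positive
   time. *)
have [->|/eqP sn1] := eqVneq s 1.
  apply: le_esum => k _; rewrite /eU /erho /etime subrr mulr0 uflow0.
  by rewrite (flow0 hS) //; apply: P; rewrite lexx ler01.
have s1' : s < 1 by rewrite lt_neqAle s1 andbT; exact/eqP.
have [fin|] := boolP (dens s < +oo)%E; last by rewrite -leNgt leye_eq => /eqP->; rewrite leey.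
have Qfin k : (Qf (w s k) (rho s k) < +oo)%E.
  apply: le_lt_trans fin; rewrite -(@esum_set1 _ _ k (fun k => Qf (w s k) (rho s k))) ?Qf_ge0//.
  apply: esum_ge; exists [set k] => //.
  by rewrite esum_fset// => i _; rewrite Qf_ge0.
have Qr k := Qf_real (Pd2c_ge0 k (P s01)) (Qfin k).
have T0 : 0 < tau s by rewrite mulr_gt0// subr_gt0.
have [mm [wm mp mn msum]] := sq_majorant (w2 s01).
have ypos t k : 0 < t -> 0 < S t (rho s) k by exact: (flow_pos d0 hS (P s01)).
have rT : rt * tau s <= 1 / 16.
  by apply: le_trans hsmall; rewrite ler_wpM2l ?(ltW rt0)// (etime_le h0).
have key N : ((window (qratio delta (rho s) (w s) (fun t => S t (rho s)) (tau s)) N)%:E <=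
    \esum_(k in [set: int]) (w s k ^+ 2 / rho s k)%:E)%E.
  apply: (flow_contraction d0 m0 T0 rT _ _ _ _ _ wm mp mn) => //.
  - by move=> k; rewrite (flow0 hS (P s01)).
  - by move=> t k /andP[t0 _]; exact: (flow_bounds d0 hS (P s01)).
  - by move=> t k /andP[t0 _]; exact: ypos.
  - by move=> k; exact: (flow_continuous hS (P s01)).
  - by move=> k t /andP[t0 _]; exact: (flow_derive hS (P s01)).
  - by move=> k; exact: (Qr k).1.
have -> : dens s = (\esum_(k in [set: int]) (w s k ^+ 2 / rho s k)%:E)%E.
  by apply: eq_esum => k _; rewrite (Qr k).2.
have -> : (\esum_(k in [set: int]) Qf (U s k) (rh s k) = \esum_(k in [set: int])
    (qratio delta (rho s) (w s) (fun t => S t (rho s)) (tau s) k)%:E)%E.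
  by apply: eq_esum => k _; rewrite /Qf /erho ypos.
have r0 k : 0 <= qratio delta (rho s) (w s) (fun t => S t (rho s)) (tau s) k.
  by rewrite /qratio divr_ge0 ?sqr_ge0// ltW// ypos.
have c := cvg_window r0; rewrite -(cvg_lim _ c)//; apply: lime_le.
  by apply/cvg_ex; eexists; exact: c.
by near=> N; exact: key.
Unshelve. all: by end_near. Qed.

Lemma rh_cube_sum s : 0 <= s <= 1 ->
  (\esum_(k in [set: int]) (rh s k ^+ 3)%:E <= (m ^+ 3)%:E)%E.
Proof.
move=> s01; apply: (@le_trans _ _ (\esum_(k in [set: int]) ((m ^+ 2)%:E * (rh s k)%:E))%E).
  apply: le_esum => k _; rewrite -EFinM lee_fin exprSr ler_wpM2r ?rh0//.
  by apply: lerXn2r; rewrite ?nnegrE ?rh0 ?rhm// ltW.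
rewrite esum_intZl ?exprn_ge0 ?(ltW m0)//; last by move=> k; rewrite lee_fin rh0.
by rewrite (Pd2c_sum d0 (Ph s01)) -EFinM lee_fin -exprSr.
Qed.

Lemma wh_sqsum s : 0 <= s <= 1 ->
  (\esum_(k in [set: int]) ((wh s k) ^+ 2)%:E < +oo)%E.
Proof.
(* A constant weight would not do here: the conclusion is summability in [k], which the local
   majorant passes on to [U]. *)
move=> s01; have [mm [wm mp mn msum]] := sq_majorant (w2 s01).
have sm : rt * `|tau s| <= 1 / 8.
  rewrite ger0_norm ?(etime_ge0 h0)//.
  by apply: (le_trans (ler_wpM2l (ltW rt0) (etime_le h0 s01))); apply: (le_trans hsmall); lra.
have Ule k : `|U s k| <= 2 * mm k.
  exact: (@uflow_le _ _ m d0 m0 _ (rM s01) _ _ wm mp mn _ _ sm).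
apply: (@le_lt_trans _ _ (\esum_(k in [set: int]) (8%:E * ((mm k) ^+ 2)%:E +
    (2 * h ^+ 2 * m)%:E * (rh s k ^+ 3)%:E))%E).
  apply: le_esum => k _; rewrite -!EFinM -EFinD lee_fin /ew.
  have u2 : U s k ^+ 2 <= 4 * mm k ^+ 2.
    rewrite -[U s k ^+ 2]ger0_norm ?sqr_ge0// normrX.
    have -> : 4 * mm k ^+ 2 = (2 * mm k) ^+ 2 by ring.
    by apply: lerXn2r; rewrite ?nnegrE// (le_trans _ (Ule k)).
  have r4 : (h * rh s k ^+ 2) ^+ 2 <= h ^+ 2 * (m * rh s k ^+ 3).
    have -> : (h * rh s k ^+ 2) ^+ 2 = h ^+ 2 * (rh s k * rh s k ^+ 3) by ring.
    rewrite ler_wpM2l ?sqr_ge0// ler_wpM2r ?exprn_ge0 ?rh0//; exact: rhm.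
  have := sqr_ge0 (U s k + h * rh s k ^+ 2).
  rewrite sqrrB sqrrD; lra.
have c3 k : (0 <= (rh s k ^+ 3)%:E)%E by rewrite lee_fin exprn_ge0// rh0.
have m2 k : (0 <= ((mm k) ^+ 2)%:E)%E by rewrite lee_fin sqr_ge0.
have C0 : 0 <= 2 * h ^+ 2 * m by rewrite !mulr_ge0 ?sqr_ge0// ltW.
rewrite esumD => [|k _|k _]; [|by rewrite mule_ge0|by rewrite mule_ge0].
rewrite !esum_intZl// lte_add_pinfty// lte_mul_pinfty//.
by apply: le_lt_trans (rh_cube_sum s01) (ltry _).
Qed.

Lemma dens_measurable : measurable_fun I01 dens.
Proof.
apply: measurable_esum => //; last by move=> k s _; exact: Qf_ge0.
by move=> k; exact: (Qf_measurable adm).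
Qed.

Let dens0 s : (0 <= dens s)%E.
Proof. by apply: esum_ge0 => k _; exact: Qf_ge0. Qed.

Lemma dens_integral :
  (\int[mu]_(s in I01) dens s = \esum_(k in [set: int]) \int[mu]_(s in I01) Qf (w s k) (rho s k))%E.
Proof.
rewrite /dens integral_esum//; last by move=> k s _; exact: Qf_ge0.
by move=> k; exact: (Qf_measurable adm).
Qed.

Lemma dens_integrable : mu.-integrable I01 dens.
Proof.
apply/integrableP; split; first exact: dens_measurable.
under eq_integral do rewrite gee0_abs//.
by rewrite dens_integral; exact: (action_sum_fin d0 act).
Qed.

Lemma rh_measurable k : measurable_fun I01 (fun s => rh s k).
Proof. exact: prim_measurable (erho_prim d0 hS adm act h0 hsmall k). Qed.

Lemma wh_measurable k : measurable_fun I01 (fun s => wh s k).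
Proof.
apply: measurable_funB; first exact: (eU_measurable d0 adm h0 hsmall).
by apply: measurable_funM => //; apply: measurable_funX; exact: rh_measurable.
Qed.

Lemma whQ_measurable k : measurable_fun I01 (fun s => Qf (wh s k) (rh s k)).
Proof. by apply: measurable_Qf => //; [exact: wh_measurable|exact: rh_measurable]. Qed.

Lemma whQ_sum_le s : 0 <= s <= 1 ->
  (\esum_(k in [set: int]) Qf (wh s k) (rh s k) <= 2%:E * dens s + (2 * h ^+ 2 * m ^+ 3)%:E)%E.
Proof.
move=> s01.
apply: (@le_trans _ _ (\esum_(k in [set: int]) (2%:E * Qf (U s k) (rh s k) +
    (2 * h ^+ 2)%:E * (rh s k ^+ 3)%:E))%E).
  by apply: le_esum => k _; rewrite -EFinM; exact: Qf_shift_le (rh0 k s01).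
have c3 k : (0 <= (rh s k ^+ 3)%:E)%E by rewrite lee_fin exprn_ge0// rh0.
have q0 k : (0 <= Qf (U s k) (rh s k))%E by exact: Qf_ge0.
have C0 : 0 <= 2 * h ^+ 2 by rewrite mulr_ge0 ?sqr_ge0.
rewrite esumD => [|k _|k _]; [|by rewrite mule_ge0|by rewrite mule_ge0].
rewrite !esum_intZl//; apply: leeD.
  by apply: lee_wpmul2l => //; exact: evolved_contraction.
by rewrite [leRHS]EFinM; apply: lee_wpmul2l; rewrite ?lee_fin//; exact: rh_cube_sum.
Qed.

Lemma whQ_integral_fin :
  (\esum_(k in [set: int]) \int[mu]_(s in I01) Qf (wh s k) (rh s k) < +oo)%E.
Proof.
rewrite -integral_esum//; [|exact: whQ_measurable|by move=> k s _; exact: Qf_ge0].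
have ci := integrable_cst01 (2 * h ^+ 2 * m ^+ 3).
have i := @integrableD _ _ _ mu _ mI _ _ (@integrableZl _ _ _ mu _ mI 2 _ dens_integrable) ci.
apply: (@le_lt_trans _ _ (\int[mu]_(s in I01) (2%:E * dens s + (2 * h ^+ 2 * m ^+ 3)%:E))%E).
  apply: ge0_le_integral => //.
  - by move=> s _; apply: esum_ge0 => k _; exact: Qf_ge0.
  - by apply: measurable_esum => //; [exact: whQ_measurable|move=> k s _; exact: Qf_ge0].
  - exact: measurable_int i.
  - by move=> s /=; rewrite in_itv/=; exact: whQ_sum_le.
have fn : (\int[mu]_(s in I01) (2%:E * dens s + (2 * h ^+ 2 * m ^+ 3)%:E))%E \is a fin_num.
  exact: (@integrable_fin_num _ _ _ mu _ mI _ i).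
by rewrite -(fineK fn) ltry.
Qed.

Lemma evolved_admissible : admissible delta (S h rho0) rho1 rh wh.
Proof.
have [_ [e0 e1] _ _ _] := adm.
have s1 : 0 <= (1 : R) <= 1 by rewrite lexx ler01.
split.
- exact: Ph.
- split; first by rewrite /erho /etime subr0 mulr1 e0.
  by rewrite /erho /etime subrr mulr0 (flow0 hS (P s1)) e1.
- exact: wh_sqsum.
- move=> k; split; first exact: wh_measurable.
  have mw : measurable_fun I01 (fun s => (wh s k ^+ 2)%:E).
    by apply/measurable_EFinP; apply: measurable_funX; exact: wh_measurable.
  apply: (@le_lt_trans _ _ (\int[mu]_(s in I01) (m%:E * Qf (wh s k) (rh s k)))%E).
    apply: ge0_le_integral => //.
    + by move=> s _; rewrite lee_fin sqr_ge0.
    + by apply: emeasurable_funM => //; exact: whQ_measurable.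
    + by move=> s /=; rewrite in_itv/= => s01; apply: sqr_le_Qf => //; exact: rhm.
  rewrite ge0_integralZl//; [|exact: whQ_measurable|by move=> s _; exact: Qf_ge0|by rewrite lee_fin ltW].
  apply: lte_mul_pinfty => //; first by rewrite lee_fin ltW.
  apply: le_lt_trans whQ_integral_fin.
  have i0 j : (0 <= \int[mu]_(s in I01) Qf (wh s j) (rh s j))%E.
    by apply: integral_ge0 => s _; exact: Qf_ge0.
  rewrite -(@esum_set1 _ _ k (fun k => \int[mu]_(s in I01) Qf (wh s k) (rh s k))%E)//.
  apply: esum_ge; exists [set k] => //.
  by rewrite esum_fset.
- move=> k s s01; exact: prim_integral (erho_prim d0 hS adm act h0 hsmall k) s01.
Qed.

Lemma evolved_action_fin : (action delta rh wh < +oo)%E.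
Proof.
rewrite /action; apply: lte_mul_pinfty => //; first by rewrite lee_fin ltW.
exact: whQ_integral_fin.
Qed.

End EvolvedAction.

(** * The evolution variational inequality *)

Section MainInequality.
Variables (R : realType) (delta : R) (S : R -> (int -> R) -> (int -> R)).
Hypotheses (d0 : 0 < delta) (hS : pme_semigroup delta S).
Local Notation m := (delta^-1).
Local Notation rt := (rate delta m).
Local Notation mu := (@lebesgue_measure R).
Local Notation I01 := (`[0%R, 1%R]%classic : set R).
Implicit Types (h s : R) (k : int) (n : nat).

Let m0 : 0 < m. Proof. by rewrite invr_gt0. Qed.
Let mI : measurable I01. Proof. exact: measurable_itv. Qed.

(** The inequality is integrated on finite windows, where the signed cross term is an integrable
    finite sum. In the limit the actions converge monotonically and the cross terms converge by
    [energy_cvg] applied to the evolved curve, whose starting point is [S h rho0]. *)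
Lemma evolved_action_le rho0 rho1 rho w h :
  admissible delta rho0 rho1 rho w -> (action delta rho w < +oo)%E ->
  0 < h -> rt * h <= 1 / 16 ->
  (action delta (erho S rho h) (ew delta S rho w h) <=
   action delta rho w + (2 * h * (energyR delta rho1 - energyR delta (S h rho0)))%:E)%E.
Proof.
move=> adm act h0 hsmall.
set rh := erho S rho h; set wh := ew delta S rho w h.
have admh := evolved_admissible d0 hS adm act h0 hsmall.
have acth := evolved_action_fin d0 hS adm act h0 hsmall.
have Qm := whQ_measurable d0 hS adm act h0 hsmall.
have Ecvg := energy_cvg d0 admh acth.
pose a k := (\int[mu]_(s in I01) Qf (wh s k) (rh s k))%E.
have a0 k : (0 <= a k)%E by apply: integral_ge0 => s _; exact: Qf_ge0.
have asum : (\esum_(k in [set: int]) a k < +oo)%E by exact: (whQ_integral_fin d0 hS adm act h0 hsmall).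
have afin k : a k \is a fin_num.
  rewrite ge0_fin_numE//; apply: le_lt_trans asum.
  rewrite -(@esum_set1 _ _ k a)//; apply: esum_ge; exists [set k] => //.
  by rewrite esum_fset.
have aint k : mu.-integrable I01 (fun s => Qf (wh s k) (rh s k)).
  apply/integrableP; split; first exact: Qm.
  under eq_integral do rewrite gee0_abs ?Qf_ge0//.
  by have := afin k; rewrite ge0_fin_numE.
have Bfin : (\int[mu]_(s in I01) dens rho w s)%E \is a fin_num.
  exact: (@integrable_fin_num _ _ _ mu _ mI _ (dens_integrable d0 adm act)).
pose WI n := \int[mu]_(s in I01) window (fun k => wh s k * rh s k) n.
have ineq n : window (fun k => fine (a k)) n + 2 * h * WI n <=
    fine (\int[mu]_(s in I01) dens rho w s)%E.
  pose f1 s := (\sum_(i <- index_enum 'I_n)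
     (Qf (wh s (Posz i)) (rh s (Posz i)) + Qf (wh s (Negz i)) (rh s (Negz i))))%E.
  pose g s := 2 * h * window (fun k => wh s k * rh s k) n.
  have wi := window_integrable n (wrho_integrable d0 admh).
  have gi : mu.-integrable I01 (EFin \o g).
    by have := @integrableZl _ _ _ mu _ mI (2 * h) _ wi.
  have fi : mu.-integrable I01 f1.
    apply: (@integrable_sum _ _ _ mu _ mI) => i _.
    exact: (@integrableD _ _ _ mu _ mI _ _ (aint _) (aint _)).
  have fE : (\int[mu]_(s in I01) f1 s)%E = (window (fun k => fine (a k)) n)%:E.
    rewrite /f1 (@integral_sum _ _ _ mu _ mI _ (fun (i : 'I_n) s =>
      Qf (wh s (Posz i)) (rh s (Posz i)) + Qf (wh s (Negz i)) (rh s (Negz i)))%E); last first.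
      by move=> i; exact: (@integrableD _ _ _ mu _ mI _ _ (aint _) (aint _)).
    rewrite /window -sumEFin; apply: eq_bigr => i _.
    by rewrite (@integralD _ _ _ mu _ mI)// EFinD !fineK.
  have gE : (\int[mu]_(s in I01) (g s)%:E)%E = (2 * h * WI n)%:E.
    have fn := @integrable_fin_num _ _ _ mu _ mI _ gi.
    by rewrite -(fineK fn); congr EFin; rewrite /WI -RintegralZl.
  rewrite -lee_fin EFinD -fE -gE fineK// -(@integralD _ _ _ mu _ mI)//.
  apply: (@le_integral _ _ _ mu _ mI).
  - exact: (@integrableD _ _ _ mu _ mI).
  - exact: (dens_integrable d0 adm act).
  move=> s /set_mem/=; rewrite in_itv/= => s01.
  have r0 k : 0 <= rh s k by exact: Pd2c_ge0 (erho_Pd2c hS adm h0 s01).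
  apply: le_trans (evolved_contraction d0 hS adm h0 hsmall s01).
  rewrite esum_int; last by move=> k; exact: Qf_ge0.
  apply: le_trans (@nneseries_lim_ge _ _ xpredT 0%N n _); last first.
    by move=> i _ _; rewrite adde_ge0 ?Qf_ge0.
  rewrite /f1 /g /window mulr_sumr -sumEFin -big_split/= big_mkord.
  apply: lee_sum => i _.
  (* The contraction bounds the sum of [Qf] at [eU]; the identity rewrites each term with the
     evolved potential, after which the cubic remainders are dropped. *)
  rewrite -(Qf_shift (eU delta rho w h s (Posz i)) h (r0 (Posz i))).
  rewrite -(Qf_shift (eU delta rho w h s (Negz i)) h (r0 (Negz i))).
  rewrite -!/(ew delta S rho w h s _) -/wh [leRHS]addeACA; apply: leeD => //.
  rewrite -EFinD lee_fin mulrDr.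
  have c k : 0 <= h ^+ 2 * rh s k ^+ 3 by rewrite mulr_ge0 ?sqr_ge0 ?exprn_ge0.
  by apply: lerD; rewrite lerDl.
have c1 : window (fun k => fine (a k)) n.+1 @[n --> \oo] -->
    fine (\esum_(k in [set: int]) a k)%E.
  have fn : (\esum_(k in [set: int]) a k)%E \is a fin_num.
    by rewrite ge0_fin_numE//; apply: esum_ge0.
  have := @cvg_window _ (fun k => fine (a k)) (fun k => fine_ge0 (a0 k)).
  under eq_esum do rewrite fineK//.
  by rewrite -{1}(fineK fn) => /fine_cvg; rewrite -(cvg_shiftS (fine \o _)).
have lim : delta * fine (\esum_(k in [set: int]) a k)%E +
    2 * h * (energyR delta (S h rho0) - energyR delta rho1) <=
    delta * fine (\int[mu]_(s in I01) dens rho w s)%E.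
  have c2 : delta * window (fun k => fine (a k)) n.+1 + 2 * h * (delta * WI n.+1) @[n --> \oo] -->
      delta * fine (\esum_(k in [set: int]) a k)%E +
      2 * h * (energyR delta (S h rho0) - energyR delta rho1).
    apply: (@cvgD _ (R : normedModType R)); first by apply: cvgM => //; exact: cvg_cst.
    by apply: cvgM => //; exact: cvg_cst.
  rewrite -(cvg_lim (@Rhausdorff R) c2); apply: limr_le; first by apply/cvg_ex; eexists; exact: c2.
  near=> n; rewrite mulrCA -mulrDr ler_wpM2l ?(ltW d0)//; exact: ineq.
have -> : action delta rho w = (delta * fine (\int[mu]_(s in I01) dens rho w s)%E)%:E.
  by rewrite /action EFinM fineK// (dens_integral adm).
have -> : action delta rh wh = (delta * fine (\esum_(k in [set: int]) a k)%E)%:E.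
  by rewrite /action EFinM fineK// ge0_fin_numE//; apply: esum_ge0.
by rewrite -EFinD lee_fin; lra.
Unshelve. all: by end_near. Qed.

Lemma constant_admissible r : Pd2c delta r ->
  admissible delta r r (fun=> r) (fun _ _ => 0).
Proof.
move=> rP; split=> //.
- by move=> s _; rewrite esum1 ?ltry// => k _; rewrite expr0n.
- move=> k; split; first exact: measurable_cst.
  under eq_integral do rewrite expr0n/=.
  by rewrite integral0 ltry.
- move=> k s _; rewrite subrr.
  under eq_integral do rewrite /lapd addr0 mulr0 subrr mul0r.
  by rewrite integral0.
Qed.

Lemma constant_action r : Pd2c delta r -> action delta (fun=> r) (fun _ _ => 0) = 0%E.
Proof.
move=> rP; rewrite /action esum1 ?mule0// => k _.
under eq_integral => s _.
  rewrite (_ : Qf 0 (r k) = 0%E); last by rewrite /Qf eqxx expr0n/= mul0r; case: ifP.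
  over.
by rewrite integral0.
Qed.

(* The curve [s |-> S^{h(1-s)} r] has velocity potential [- h rho^2], so the
   energy decreases at a rate at most [delta sum rho^3]. *)
Lemma energyR_flow_ge r h : Pd2c delta r -> 0 < h -> rt * h <= 1 / 16 ->
  energyR delta r - h / delta ^+ 2 <= energyR delta (S h r).
Proof.
move=> rP h0 hsmall.
have adm := constant_admissible rP.
have act : (action delta (fun=> r) (fun _ _ => 0%R) < +oo)%E by rewrite constant_action// ltry.
have admh := evolved_admissible d0 hS adm act h0 hsmall.
have acth := evolved_action_fin d0 hS adm act h0 hsmall.
have Ecvg := energy_cvg d0 admh acth.
suff : - (h / delta ^+ 2) <= energyR delta (S h r) - energyR delta r by lra.
rewrite -(cvg_lim (@Rhausdorff R) Ecvg); apply: limr_ge; first by apply/cvg_ex; eexists; exact: Ecvg.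
near=> n.
set rh := erho S (fun=> r) h; set wh := ew delta S (fun=> r) (fun _ _ => 0) h.
have wE s k : 0 <= s <= 1 -> wh s k = - h * rh s k ^+ 2.
  (* The linearised flow of the zero potential is zero: [uflow_le] with zero weight. *)
  move=> s01; rewrite /wh /ew (_ : eU _ _ _ _ _ _ = 0) ?sub0r ?mulNr//.
  apply/eqP; rewrite -normr_le0 -[X in _ <= X](mulr0 2) /eU.
  apply: (@uflow_le _ _ m d0 m0 _ _ _ (fun=> 0)) => //.
  - by move=> j; rewrite ger0_norm ?(Pd2c_ge0 _ rP)// Pd2c_le.
  - by move=> j; rewrite normr0.
  - have rt0 : 0 <= rt by rewrite /rate divr_ge0 ?exprn_ge0 ?(ltW d0)// mulr_ge0// ltW.
    rewrite ger0_norm ?(etime_ge0 h0)//.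
    by apply: (le_trans (ler_wpM2l rt0 (etime_le h0 s01))); apply: (le_trans hsmall); lra.
have wi := window_integrable n.+1 (wrho_integrable d0 admh).
(* The cubes of the density sum to at most [m ^+ 3], namely [m ^+ 2] from the sup bound and [m] from
   the mass; the factor [delta] leaves [h / delta ^+ 2]. *)
have c : - (h / delta ^+ 2) = delta * \int[mu]_(s in I01) (- h * m ^+ 3).
  rewrite Rintegral_cst//.
  have := @lebesgue_measure_itv R `[0%R, 1%R]; rewrite /= lte_fin ltr01 => ->.
  by rewrite /= subr0; field; rewrite gt_eqF.
rewrite c ler_wpM2l ?(ltW d0)//; apply: (@le_Rintegral _ _ _ mu _ _ _ mI) => //.
  exact: integrable_cst01.
move=> s /=; rewrite in_itv/= => s01.
have Ph := erho_Pd2c hS adm h0 s01.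
have -> : window (fun k => wh s k * rh s k) n.+1 = - h * window (fun k => rh s k ^+ 3) n.+1.
  by rewrite /window mulr_sumr; apply: eq_bigr => i _; rewrite !wE//; ring.
rewrite !mulNr lerN2 ler_wpM2l ?(ltW h0)// -lee_fin.
apply: le_trans (rh_cube_sum d0 hS adm h0 s01).
by apply: window_le_esum => k; rewrite exprn_ge0// (Pd2c_ge0 _ Ph).
Unshelve. all: by end_near. Qed.

Lemma action_ge0 (rho w : R -> int -> R) : (0 <= action delta rho w)%E.
Proof.
rewrite /action mule_ge0 ?lee_fin ?(ltW d0)//; apply: esum_ge0 => k _.
by apply: integral_ge0 => s _; exact: Qf_ge0.
Qed.

Lemma Dd2_ge0 r e : (0 <= Dd2 delta r e)%E.
Proof. by apply: le_ereal_inf_tmp => _ [rho [w [_ ->]]]; exact: action_ge0. Qed.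

Lemma Dd2_flow_le r e h : Pd2c delta r -> (Dd2 delta r e < +oo)%E ->
  0 < h -> rt * h <= 1 / 16 ->
  (Dd2 delta (S h r) e <= Dd2 delta r e +
   (2 * h * (energyR delta e - energyR delta r + h / delta ^+ 2))%:E)%E.
Proof.
move=> rP Dfin h0 hsmall.
rewrite -leeBlDr//; apply: le_ereal_inf_tmp => _ [rho [w [adm ->]]].
rewrite leeBlDr//.
have [act|] := boolP (action delta rho w < +oo)%E; last first.
  by rewrite -leNgt leye_eq => /eqP->; rewrite leey.
apply: (@le_trans _ _ (action delta (erho S rho h) (ew delta S rho w h))).
  apply: ereal_inf_lbound; exists (erho S rho h), (ew delta S rho w h); split=> //.
  exact: (evolved_admissible d0 hS adm act h0 hsmall).
apply: (le_trans (evolved_action_le adm act h0 hsmall)).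
apply: leeD => //; rewrite lee_fin ler_wpM2l ?mulr_ge0 ?(ltW h0)//.
by have := energyR_flow_ge rP h0 hsmall; lra.
Qed.

End MainInequality.

Theorem theorem1p3 (R : realType) (delta : R) (S : R -> (int -> R) -> (int -> R)) :
  0 < delta ->
  pme_semigroup delta S ->
  lambda_contractive delta 0 S (energy delta).
Proof.
move=> d0 hS rhob etab rP eP Dfin.
have Dfn : Dd2 delta rhob etab \is a fin_num by rewrite ge0_fin_numE// Dd2_ge0.
rewrite mul0r mul0e adde0 !energyE//.
set E := energyR delta etab - energyR delta rhob.
have rt0 : 0 < rate delta delta^-1.
  by rewrite /rate divr_gt0 ?exprn_gt0// mulr_gt0// invr_gt0.
apply/lee_addgt0Pr => e e0; rewrite -EFinB -/E -EFinD.
(* The first bound is the smallness required by the power series, the second makes the error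
   [t / delta ^+ 2] at most [e]. *)
pose t0 := Num.min (1 / 16 / rate delta delta^-1) (e * delta ^+ 2).
have t00 : 0 < t0.
  by rewrite lt_min divr_gt0//= mulr_gt0// exprn_gt0.
(* The upper limit is an infimum of suprema over the right neighbourhoods of 0, so it suffices to
   bound the quotient on []0, t0[]. *)
apply: (@le_trans _ _ (ereal_sup ((fun t : R =>
    (Dd2 delta (S t rhob) etab - Dd2 delta rhob etab) * ((2 * t)^-1)%:E)%E @` `]0%R, t0[))).
  apply: ereal_inf_lbound; exists `]0%R, t0[%classic => //.
  near=> t; rewrite /= in_itv/=; apply/andP; split; near: t.
    exact: nbhs_right_gt.
  exact: nbhs_right_lt.
apply: ge_ereal_sup => y [t]; rewrite /= in_itv/= => /andP[tp tt0] <- {y}.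
have [ts te] : rate delta delta^-1 * t <= 1 / 16 /\ t <= e * delta ^+ 2.
  move: tt0; rewrite /t0 lt_min => /andP[/ltW + /ltW->].
  by rewrite ler_pdivlMr// mulrC.
have D := Dd2_flow_le d0 hS rP Dfin tp ts.
have D1fn : Dd2 delta (S t rhob) etab \is a fin_num.
  rewrite ge0_fin_numE ?Dd2_ge0//; apply: (le_lt_trans D).
  by rewrite -(fineK Dfn) -EFinD ltry.
move: D; rewrite -(fineK Dfn) -(fineK D1fn) -EFinD -EFinB -EFinM !lee_fin => D.
rewrite -/(_ / _) ler_pdivrMr ?mulr_gt0//.
have td : t / delta ^+ 2 <= e by rewrite ler_pdivrMr ?exprn_gt0.
move: D; rewrite -lerBlDl => /le_trans; apply.
by rewrite mulrC ler_wpM2r ?mulr_ge0 ?(ltW tp)// /E; lra.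
Unshelve. all: by end_near. Qed.
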